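(* Let $\Lambda$ be a compact path-connected metric space and let $\mathbb{E}$ and $\mathbb{F}$ be subbundles of the trivial bundle $\Theta(\mathbb{R}^d)=\Lambda\times\mathbb{R}^d$. Then there exists a parametrized linear vector field $\mathbb{A}\colon\Lambda\times\mathbb{Z}\to GL(d,\mathbb{R})$ such that $L\colon\Lambda\to\mathcal{L}(\ell_0(\mathbb{R}^d))$, $(L(\lambda)\phi)(n)=\phi(n+1)-\mathbb{A}_n(\lambda)\phi(n)$, is a continuous family of Fredholm operators with $\operatorname{ind}(L)=[\mathbb{E}]-[\mathbb{F}]\in KO(\Lambda)$.
   Context: $\ell_0(\mathbb{R}^d)$: sequences $\mathbb{Z}\to\mathbb{R}^d$ converging to $0$ at $\pm\infty$, sup norm. $KO(\Lambda)$: Grothendieck group of isomorphism classes of real vector bundles over $\Lambda$. Index bundle: for a continuous family $L\colon\Lambda\to\Phi(X,Y)$ of Fredholm operators between Banach spaces, choose a finite-dimensional $V\subset Y$ with $\operatorname{im}L(\lambda)+V=Y$ for all $\lambda$; then $E(L,V):=\bigcup_\lambda\{\lambda\}\times L(\lambda)^{-1}(V)$ is a vector bundle and $\operatorname{ind}(L):=[E(L,V)]-[\Lambda\times V]\in KO(\Lambda)$. *)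

(* Defs.v *)
From HB Require Import structures.
From mathcomp Require Import all_boot all_order all_algebra.
From mathcomp Require Import all_classical all_reals all_analysis.
Set Implicit Arguments. Unset Strict Implicit. Unset Printing Implicit Defensive.
Import Order.TTheory GRing.Theory Num.Theory.
Import numFieldNormedType.Exports.
Local Open Scope classical_set_scope.
Local Open Scope ring_scope.

Section Defs.
Variable R : realType.

Definition path_connected (T : topologicalType) : Prop :=
  forall x y : T, exists g : R -> T,
    {within `[0, 1], continuous g} /\ g 0 = x /\ g 1 = y.

Definition lin_subspace (X : lmodType R) (S : set X) : Prop :=
  S 0 /\ (forall (a : R) x y, S x -> S y -> S (a *: x + y)).

Definition span (X : lmodType R) (k : nat) (b : 'I_k -> X) : set X :=
  [set x | exists c : 'I_k -> R, x = \sum_(i < k) c i *: b i].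

Variable Lam : metricType R.

(** A (finite rank) vector subbundle E of the trivial bundle Lam x X, where
    the topology of X is given by the norm N: each fibre is a linear subspace,
    and E is locally trivial, i.e. admits continuous local frames. *)
Definition is_bundle (X : lmodType R) (N : X -> R) (E : Lam -> set X) : Prop :=
  (forall l, lin_subspace (E l)) /\
  forall l0 : Lam, exists (k : nat) (s : 'I_k -> Lam -> X) (d : R), 0 < d /\
    (forall i l, ball l0 d l -> forall e : R, 0 < e -> exists eta : R, 0 < eta /\
       forall m, ball l0 d m -> ball l eta m -> N (s i m - s i l) < e) /\
    (forall l, ball l0 d l ->
       (forall i, E l (s i l)) /\
       (forall x, E l x -> exists! c : 'I_k -> R, x = \sum_(i < k) c i *: s i l)).

Definition tot_continuous (X Y : lmodType R) (NX : X -> R) (NY : Y -> R)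
    (E : Lam -> set X) (f : Lam -> X -> Y) : Prop :=
  forall l x, E l x -> forall e : R, 0 < e -> exists d : R, 0 < d /\
    forall m y, E m y -> ball l d m -> NX (y - x) < d -> NY (f m y - f l x) < e.

Definition bundle_iso (X Y : lmodType R) (NX : X -> R) (E : Lam -> set X)
    (NY : Y -> R) (F : Lam -> set Y) : Prop :=
  exists (f : Lam -> X -> Y) (g : Lam -> Y -> X),
    (forall l x, E l x -> F l (f l x)) /\
    (forall l y, F l y -> E l (g l y)) /\
    (forall l (a : R) x y, E l x -> E l y -> f l (a *: x + y) = a *: f l x + f l y) /\
    (forall l x, E l x -> g l (f l x) = x) /\
    (forall l y, F l y -> f l (g l y) = y) /\
    tot_continuous NX NY E f /\ tot_continuous NY NX F g.

Definition bsum (X Y : lmodType R) (E : Lam -> set X) (F : Lam -> set Y) :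
  Lam -> set (X * Y)%type := fun l => [set p | E l p.1 /\ F l p.2].
Definition nsum (X Y : lmodType R) (NX : X -> R) (NY : Y -> R) : (X * Y)%type -> R :=
  fun p => Num.max (NX p.1) (NY p.2).

(** Equality in the Grothendieck group KO(Lam):  [E1] - [F1] = [E2] - [F2]
    iff E1 + F2 + G is isomorphic to E2 + F1 + G for some bundle G. *)
Definition ko_eq (X1 Y1 X2 Y2 : lmodType R)
    (N1 : X1 -> R) (E1 : Lam -> set X1) (M1 : Y1 -> R) (F1 : Lam -> set Y1)
    (N2 : X2 -> R) (E2 : Lam -> set X2) (M2 : Y2 -> R) (F2 : Lam -> set Y2) : Prop :=
  exists (W : normedModType R) (G : Lam -> set W),
    is_bundle (fun w : W => `|w|) G /\
    bundle_iso (nsum (nsum N1 M2) (fun w : W => `|w|)) (bsum (bsum E1 F2) G)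
               (nsum (nsum N2 M1) (fun w : W => `|w|)) (bsum (bsum E2 F1) G).

Variable d : nat.
Definition seqd := (int -> 'cV[R]_d)%type.
Definition ell0 : set seqd :=
  [set phi | forall e : R, 0 < e -> exists M : int, forall n : int,
      M <= `|n| -> `|phi n| < e].
Definition supn (phi : seqd) : R := sup (range (fun n => `|phi n|)).

Definition fredholm (T : seqd -> seqd) : Prop :=
  (forall phi, ell0 phi -> ell0 (T phi)) /\
  (forall (a : R) phi psi, ell0 phi -> ell0 psi -> T (a *: phi + psi) = a *: T phi + T psi) /\
  (exists C : R, forall phi, ell0 phi -> supn (T phi) <= C * supn phi) /\
  (exists (k : nat) (b : 'I_k -> seqd), (forall i, ell0 (b i)) /\
      [set phi | ell0 phi /\ T phi = 0] = span b) /\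
  (forall psi, ell0 psi ->
     (forall e : R, 0 < e -> exists phi, ell0 phi /\ supn (T phi - psi) < e) ->
     exists phi, ell0 phi /\ T phi = psi) /\
  (exists (k : nat) (b : 'I_k -> seqd), (forall i, ell0 (b i)) /\
      forall psi, ell0 psi -> exists phi v, ell0 phi /\ span b v /\ psi = T phi + v).

Definition cont_fredholm_family (Lf : Lam -> seqd -> seqd) : Prop :=
  (forall l, fredholm (Lf l)) /\
  (forall l (e : R), 0 < e -> exists dl : R, 0 < dl /\ forall m, ball l dl m ->
      forall phi, ell0 phi -> supn (Lf m phi - Lf l phi) <= e * supn phi).

Definition transversal (Lf : Lam -> seqd -> seqd) (k : nat) (b : 'I_k -> seqd) : Prop :=
  (forall i, ell0 (b i)) /\
  forall l psi, ell0 psi -> exists phi v, ell0 phi /\ span b v /\ psi = Lf l phi + v.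

Definition EL (Lf : Lam -> seqd -> seqd) (k : nat) (b : 'I_k -> seqd) : Lam -> set seqd :=
  fun l => [set phi | ell0 phi /\ span b (Lf l phi)].

Definition Lop (A : Lam -> int -> 'M[R]_d) : Lam -> seqd -> seqd :=
  fun l phi n => phi (n + 1) - A l n *m phi n.

(** ind(L) = [E] - [F]:  for every admissible V, E(L,V) is a bundle and
    [E(L,V)] - [Lam x V] = [E] - [F]. *)
Definition index_eq (Lf : Lam -> seqd -> seqd)
    (E F : Lam -> set 'cV[R]_d) : Prop :=
  (exists (k : nat) (b : 'I_k -> seqd), transversal Lf b) /\
  forall (k : nat) (b : 'I_k -> seqd), transversal Lf b ->
    is_bundle supn (EL Lf b) /\
    ko_eq supn (EL Lf b) supn (fun _ => span b)
          (fun v : 'cV[R]_d => `|v|) E (fun v : 'cV[R]_d => `|v|) F.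

End Defs.

(* Main.v *)
Require Import Defs.
From HB Require Import structures.
From mathcomp Require Import all_boot all_order all_algebra.
From mathcomp Require Import all_classical all_reals all_analysis.
From mathcomp Require Import ring lra zify.
Import Order.TTheory GRing.Theory Num.Theory.
Import numFieldNormedType.Exports.
Local Open Scope classical_set_scope.
Local Open Scope ring_scope.
Set Implicit Arguments. Unset Strict Implicit. Unset Printing Implicit Defensive.

(**
  Let P and Q be the orthogonal projections onto E and F, and take A_n to be
  P/2 + 2(1-P) for n >= 0 and Q/2 + 2(1-Q) for n < 0.  The scalar recursions
  u(n+1) = u(n)/2 + psi(n) and h(n+1) = 2h(n) + psi(n) have unique solutions
  U psi and H psi in l_0, which do not depend on the parameter.  The solutions
  of L phi = psi in l_0 are then obtained from P U + (1-P) H + 2^-n e on n >= 0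
  (e in E) and Q U + (1-Q) H + 2^n f on n <= 0 (f in the complement of F); the two
  halves match at 0 iff T(e, psi) := Q e - Q(1-P)(U psi - H psi)(0) vanishes.
  So E(L,V) is the kernel of the bundle map T : E + V -> F, which is onto
  exactly when V is transversal, and a continuous right inverse of T splits
  E + V as E(L,V) + F.
*)

(** The numbers 1/2 and 2 make both half-lines hyperbolic: a solution [phi] of the homogeneous
    equation that tends to 0 has [phi 0] in E because of the decay to the right, and in the
    complement of F because of the decay to the left. This is why the two bundles enter the index
    with opposite signs. Two demands shape the proof. The index has to be computed with every
    admissible V, so all that may be used of V is that T is onto. And bundles are given by local
    frames, while global continuous data are wanted. Orthogonal projections meet the second demand:
    being determined by their range, they are continuous as soon as the local formulas are.
    Transposes then yield the right inverse T^t (T T^t)^-1, which is just as explicit in the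
    parameter. Since U and H are fixed bounded operators, each family in the proof is put together
    from fixed operators and continuous matrices, and inherits its continuity from P and Q. *)

Section MatrixNorm.
Variable R : realType.

Lemma mx_norm_entry m n (A : 'M[R]_(m, n)) i j : `|A i j| <= `|A|.
Proof.
rewrite [leRHS]/Num.norm /= mx_normrE.
exact: (le_bigmax _ (fun ij : 'I_m * 'I_n => `|A ij.1 ij.2|) (i, j)).
Qed.

Lemma mx_norm_le m n (A : 'M[R]_(m, n)) (c : R) :
  0 <= c -> (forall i j, `|A i j| <= c) -> `|A| <= c.
Proof.
move=> c0 Ac; rewrite [leLHS]/Num.norm /= mx_normrE; by apply/bigmax_leP.
Qed.

(** The norm is the largest absolute value of an entry, which is not submultiplicative; an entry of
    the product sums [n] terms, hence the factor. *)
Lemma mx_norm_mul m n p (A : 'M[R]_(m, n)) (B : 'M[R]_(n, p)) :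
  `|A *m B| <= n%:R * `|A| * `|B|.
Proof.
apply: mx_norm_le => [|i j]; first by rewrite !mulr_ge0.
rewrite mxE (le_trans (ler_norm_sum _ _ _))//.
rewrite (@le_trans _ _ (\sum_(k < n) `|A| * `|B|))//.
  by apply: ler_sum => k _; rewrite normrM ler_pM// mx_norm_entry.
by rewrite sumr_const card_ord -mulrA mulr_natl.
Qed.

(** * Continuity of matrix operations along a filter *)

Section Cvg.
Context {T : Type} {F : set_system T} {FF : Filter F}.

Lemma cvg_mxP m n (f : T -> 'M[R]_(m, n)) (A : 'M[R]_(m, n)) :
  f x @[x --> F] --> A <-> forall i j, f x i j @[x --> F] --> A i j.
Proof.
split=> [fA i j|fA].
  apply/cvgrPdist_lt => e e0; move/cvgrPdist_lt : fA => /(_ e e0).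
  apply: filterS => x; apply: le_lt_trans.
  by have := mx_norm_entry (A - f x) i j; rewrite !mxE.
apply/cvgrPdist_le => e e0.
have H : \near F, forall ij : 'I_m * 'I_n, `|A ij.1 ij.2 - f F ij.1 ij.2| <= e.
  apply: filter_forall => -[i j] /=.
  by move: (fA i j) => /cvgrPdist_le /(_ e e0).
apply: filterS H => x Hx; apply: mx_norm_le => [|i j]; first exact: ltW.
by have := Hx (i, j); rewrite !mxE.
Qed.

Lemma cvg_mulmx m n p (f : T -> 'M[R]_(m, n)) (g : T -> 'M[R]_(n, p))
    (A : 'M[R]_(m, n)) (B : 'M[R]_(n, p)) :
  f x @[x --> F] --> A -> g x @[x --> F] --> B ->
  f x *m g x @[x --> F] --> A *m B.
Proof.
move=> /cvg_mxP fA /cvg_mxP gB; apply/cvg_mxP => i j.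
under eq_fun do rewrite mxE; rewrite mxE.
apply: cvg_big => [|k _]; first exact: add_continuous.
exact: cvgM.
Qed.

Lemma cvg_trmx m n (f : T -> 'M[R]_(m, n)) (A : 'M[R]_(m, n)) :
  f x @[x --> F] --> A -> (f x)^T @[x --> F] --> A^T.
Proof.
move=> /cvg_mxP fA; apply/cvg_mxP => i j; under eq_fun do rewrite mxE.
by rewrite mxE; exact: fA.
Qed.

Lemma cvg_det n (f : T -> 'M[R]_n) (A : 'M[R]_n) :
  f x @[x --> F] --> A -> \det (f x) @[x --> F] --> \det A.
Proof.
move=> /cvg_mxP fA; rewrite /determinant.
apply: cvg_big => [|s _]; first exact: add_continuous.
apply: cvgM; first exact: cvg_cst.
by apply: cvg_big => // ; exact: mul_continuous.
Qed.

Lemma cvg_adj n (f : T -> 'M[R]_n) (A : 'M[R]_n) :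
  f x @[x --> F] --> A -> \adj (f x) @[x --> F] --> \adj A.
Proof.
move=> /cvg_mxP fA; apply/cvg_mxP => i j.
under eq_fun do rewrite mxE; rewrite mxE /cofactor.
apply: cvgM; first exact: cvg_cst.
apply: cvg_det; apply/cvg_mxP => k l.
by under eq_fun do rewrite !mxE; rewrite !mxE; exact: fA.
Qed.

Lemma cvg_unitmx n (f : T -> 'M[R]_n) (A : 'M[R]_n) :
  f x @[x --> F] --> A -> A \in unitmx -> \near F, f F \in unitmx.
Proof.
move=> /cvg_det fA; rewrite unitmxE unitfE => A0.
(* The radius is [|\det A|] itself: the determinant 0 of a singular matrix lies at exactly that
   distance from [\det A]. *)
move/cvgrPdist_lt : fA => /(_ `|\det A|); rewrite normr_gt0 => /(_ A0).
apply: filterS => x; rewrite unitmxE unitfE; apply: contraTneq => ->.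
by rewrite subr0 ltxx.
Qed.

Lemma cvg_invmx n (f : T -> 'M[R]_n) (A : 'M[R]_n) :
  f x @[x --> F] --> A -> A \in unitmx -> invmx (f x) @[x --> F] --> invmx A.
Proof.
move=> fA uA; have uf := cvg_unitmx fA uA.
(* [invmx] returns its argument on singular matrices, so the adjugate formula is available only near
   the limit. *)
apply: (@cvg_trans _ (((\det (f x))^-1 *: \adj (f x)) @[x --> F])).
  by apply: near_eq_cvg; apply: filterS uf => x ux; rewrite /invmx ux.
rewrite /invmx uA; apply: cvgZ; last exact: cvg_adj.
apply: cvgV; last exact: cvg_det.
by move: uA; rewrite unitmxE unitfE.
Qed.

Lemma cvg_col_mx m1 m2 n (f : T -> 'M[R]_(m1, n)) (g : T -> 'M[R]_(m2, n))
    (A : 'M[R]_(m1, n)) (B : 'M[R]_(m2, n)) :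
  f x @[x --> F] --> A -> g x @[x --> F] --> B ->
  col_mx (f x) (g x) @[x --> F] --> col_mx A B.
Proof.
move=> /cvg_mxP fA /cvg_mxP gB; apply/cvg_mxP => i j.
by under eq_fun do rewrite mxE; rewrite mxE; case: (fintype.split i) => k; [exact: fA|exact: gB].
Qed.

Lemma cvg_row_mx m n1 n2 (f : T -> 'M[R]_(m, n1)) (g : T -> 'M[R]_(m, n2))
    (A : 'M[R]_(m, n1)) (B : 'M[R]_(m, n2)) :
  f x @[x --> F] --> A -> g x @[x --> F] --> B ->
  row_mx (f x) (g x) @[x --> F] --> row_mx A B.
Proof.
move=> /cvg_mxP fA /cvg_mxP gB; apply/cvg_mxP => i j.
by under eq_fun do rewrite mxE; rewrite mxE; case: (fintype.split j) => k; [exact: fA|exact: gB].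
Qed.

End Cvg.

Lemma mulmx_col_inj m n (A B : 'M[R]_(m, n)) :
  (forall x : 'cV[R]_n, A *m x = B *m x) -> A = B.
Proof.
move=> AB; apply/matrixP => i j.
have := AB (delta_mx j 0); rewrite -!colE => /matrixP /(_ i 0).
by rewrite !mxE.
Qed.

Lemma trmx_self_eq0 n (x : 'cV[R]_n) : x^T *m x = 0 -> x = 0.
Proof.
move/matrixP/(_ 0 0); rewrite !mxE => x0.
apply/matrixP => i j; rewrite ord1 mxE; apply/eqP.
rewrite -sqrf_eq0 expr2.
have /psumr_eq0P/(_ x0 i isT) : forall k, true -> 0 <= x^T 0 k * x k 0.
  by move=> k _; rewrite mxE -expr2 sqr_ge0.
by rewrite mxE => ->.
Qed.

Lemma unitmx_inj n (A : 'M[R]_n) :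
  (forall x : 'cV[R]_n, A *m x = 0 -> x = 0) -> A \in unitmx.
Proof.
move=> Ainj; rewrite -unitmx_tr -row_free_unit; apply: inj_row_free => v vA.
apply: trmx_inj; rewrite trmx0; apply: Ainj.
by apply: trmx_inj; rewrite trmx_mul trmxK vA trmx0.
Qed.

End MatrixNorm.

(** * Independent generators of a span *)

Section Span.
Variables (R : realType) (X : lmodType R).

(** An admissible V comes with generators that may be dependent, whereas a frame needs unique
    coefficients. Induction on the number of generators: the first one is dropped when the others
    already span it. *)
Lemma span_indep k (b : 'I_k -> X) : exists k' (b' : 'I_k' -> X),
  Defs.span b' = Defs.span b /\
  (forall c : 'I_k' -> R, \sum_i c i *: b' i = 0 -> forall i, c i = 0).
Proof.
elim: k b => [|k IH] b; first by exists 0%N, b; split => // c _ [].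
have [k' [b' [sb' ib']]] := IH (fun i => b (lift ord0 i)).
have spanS (x : X) : Defs.span b x <->
    exists a y, Defs.span b' y /\ x = a *: b ord0 + y.
  rewrite sb'; split=> [[c ->]|[a [_ [[c ->] ->]]]].
    rewrite big_ord_recl; exists (c ord0), (\sum_i c (lift ord0 i) *: b (lift ord0 i)).
    by split => //; exists (fun i => c (lift ord0 i)).
  exists (fun i => if unlift ord0 i is Some j then c j else a).
  rewrite big_ord_recl unlift_none; congr (_ + _).
  by apply: eq_bigr => i _; rewrite liftK.
have [[c0 b0]|b0] := pselect (Defs.span b' (b ord0)).
  exists k', b'; split => //; apply/seteqP; split => x.
    by move=> xb; apply/spanS; exists 0, x; rewrite scale0r add0r.
  move=> /spanS[a [_ [[c ->] ->]]]; exists (fun i => a * c0 i + c i).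
  rewrite b0 scaler_sumr -big_split; apply: eq_bigr => i _.
  by rewrite /= scalerDl scalerA.
exists k'.+1, (fun i => if unlift ord0 i is Some j then b' j else b ord0).
split.
  apply/seteqP; split => x.
    move=> [c ->]; apply/spanS; rewrite big_ord_recl unlift_none.
    exists (c ord0), (\sum_i c (lift ord0 i) *: b' i); split.
      by exists (fun i => c (lift ord0 i)).
    by congr (_ + _); apply: eq_bigr => i _; rewrite liftK.
  move=> /spanS[a [_ [[c ->] ->]]].
  exists (fun i => if unlift ord0 i is Some j then c j else a).
  rewrite big_ord_recl !unlift_none; congr (_ + _).
  by apply: eq_bigr => i _; rewrite !liftK.
move=> c; rewrite big_ord_recl unlift_none.
under eq_bigr do rewrite liftK.
move=> c0.
have c00 : c ord0 = 0.
  apply/eqP; apply: contrapT => /negP c00; apply: b0.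
  exists (fun i => - (c ord0)^-1 * c (lift ord0 i)).
  under eq_bigr do rewrite -scalerA.
  move/eqP: c0; rewrite -scaler_sumr addr_eq0 => /eqP c0.
  by rewrite scaleNr -scalerN -c0 scalerA mulVf// scale1r.
move: c0; rewrite c00 scale0r add0r => /ib' H i.
by case: (unliftP ord0 i) => [j|] ->.
Qed.

End Span.

(** * Subbundles of a trivial bundle as continuous families of orthogonal projections *)

Section Projection.
Variable R : realType.

Definition orthproj n (P : 'M[R]_n) (S : set 'cV[R]_n) : Prop :=
  [/\ P^T = P, P *m P = P & forall x, S x <-> P *m x = x].

(** Equal ranges give [Q *m P = P] and [P *m Q = Q]; transposing the first, which symmetry allows,
    turns it into [P *m Q = P]. *)
Lemma orthproj_unique n (P Q : 'M[R]_n) S :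
  orthproj P S -> orthproj Q S -> P = Q.
Proof.
move=> [PT PP PS] [QT QQ QS].
have QP : Q *m P = P.
  by apply: mulmx_col_inj => x; rewrite -mulmxA; apply/QS/PS; rewrite mulmxA PP.
have PQ : P *m Q = Q.
  by apply: mulmx_col_inj => x; rewrite -mulmxA; apply/PS/QS; rewrite mulmxA QQ.
by rewrite -PT -QP trmx_mul PT QT PQ.
Qed.

Lemma gram_unitmx n k (S : 'M[R]_(n, k)) :
  (forall c : 'cV[R]_k, S *m c = 0 -> c = 0) -> S^T *m S \in unitmx.
Proof.
move=> Sinj; apply: unitmx_inj => x Sx; apply: Sinj; apply: trmx_self_eq0.
by rewrite trmx_mul -mulmxA (mulmxA S^T) Sx mulmx0.
Qed.

(** The least-squares projection onto the column space of [S]. *)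
Lemma gram_orthproj n k (S : 'M[R]_(n, k)) :
  (forall c : 'cV[R]_k, S *m c = 0 -> c = 0) ->
  orthproj (S *m invmx (S^T *m S) *m S^T) [set x | exists c, x = S *m c].
Proof.
move=> /gram_unitmx uG; have GT : (S^T *m S)^T = S^T *m S by rewrite trmx_mul trmxK.
split.
- by rewrite !trmx_mul trmxK trmx_inv GT mulmxA.
- by rewrite !mulmxA -[S *m _ *m S^T *m S]mulmxA -(mulmxA S) mulVmx// mulmx1.
- move=> x; split => [[c ->]|<-].
    by rewrite -!mulmxA (mulmxA S^T) mulKmx.
  by exists (invmx (S^T *m S) *m (S^T *m x)); rewrite !mulmxA.
Qed.

Variables (Lam : metricType R) (n : nat).

(** A local frame, written as the columns of a matrix [S l], gives the projection by the
    least-squares formula, which is continuous in [l]. By uniqueness the pointwise chosen [P] agrees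
    with each such formula near its centre, so continuity holds everywhere. *)
Lemma bundle_orthproj (E : Lam -> set 'cV[R]_n) :
  is_bundle (fun v : 'cV[R]_n => `|v|) E ->
  exists P : Lam -> 'M[R]_n, continuous P /\ forall l, orthproj (P l) (E l).
Proof.
move=> [lE fE].
have loc l0 : exists k (S : Lam -> 'M[R]_(n, k)),
    S x @[x --> l0] --> S l0 /\ \forall l \near l0,
      (S l)^T *m S l \in unitmx /\
      orthproj (S l *m invmx ((S l)^T *m S l) *m (S l)^T) (E l).
  have [k [s [r [r0 [sc sE]]]]] := fE l0.
  pose S l := \matrix_(a < n, i < k) s i l a 0.
  have SE l (c : 'cV[R]_k) : S l *m c = \sum_i c i 0 *: s i l.
    apply/matrixP => a j; rewrite mxE summxE; apply: eq_bigr => i _.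
    by rewrite !mxE ord1 mulrC.
  exists k, S; split.
    apply/cvg_mxP => a i; apply/cvgrPdist_lt => e e0.
    have [eta [eta0 H]] := sc i l0 (ballxx _ r0) e e0.
    near=> m.
    have nm : `|s i m - s i l0| < e.
      by apply: H; near: m; apply: nbhsx_ballx.
    apply: le_lt_trans nm; rewrite !mxE distrC.
    by have := mx_norm_entry (s i m - s i l0) a 0; rewrite !mxE.
  near=> l.
  have lr : ball l0 r l by near: l; apply: nbhsx_ballx.
  have [sEl sU] := sE l lr.
  have Sinj (c : 'cV[R]_k) : S l *m c = 0 -> c = 0.
    (* Injectivity of [S l] is uniqueness of the frame coefficients of the zero vector. *)
    rewrite SE => c0; have [c' [_ uc]] := sU 0 (lE l).1.
    have h1 := uc _ (esym c0).
    have h2 : c' = fun=> 0.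
      by apply: uc; rewrite big1// => i _; rewrite scale0r.
    apply/matrixP => i j; rewrite ord1 mxE.
    by rewrite -[LHS]/((fun i => c i 0) i) -h1 h2.
  split; first exact: gram_unitmx.
  suff -> : E l = [set x | exists c, x = S l *m c] by exact: gram_orthproj.
  apply/seteqP; split => x.
    move=> /sU [c [-> _]]; exists (\col_i c i); rewrite SE.
    by apply: eq_bigr => i _; rewrite mxE.
  move=> [c ->]; rewrite SE; apply: big_ind; first exact: (lE l).1.
    by move=> y z Ey Ez; rewrite -[y]scale1r; exact: (lE l).2.
  by move=> i _; rewrite -[_ *: _]addr0; apply: (lE l).2 => //; exact: (lE l).1.
have pt l : exists P, orthproj P (E l).
  have [k [S [_ nS]]] := loc l; have [_ pS] := nbhs_singleton nS.
  by exists (S l *m invmx ((S l)^T *m S l) *m (S l)^T).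
have [P PE] := choice pt.
exists P; split => // l0.
have [k [S [Sc nS]]] := loc l0.
rewrite /continuous_at.
have -> : P l0 = S l0 *m invmx ((S l0)^T *m S l0) *m (S l0)^T.
  by have [_ pS] := nbhs_singleton nS; exact: orthproj_unique (PE _) pS.
apply: (@cvg_trans _ ((S l *m invmx ((S l)^T *m S l) *m (S l)^T) @[l --> l0])).
  apply: near_eq_cvg; apply: filterS nS => l [_ pS].
  exact: orthproj_unique pS (PE _).
have STc : (S l)^T @[l --> l0] --> (S l0)^T by apply: cvg_trmx.
apply: (cvg_mulmx _ STc); apply: (cvg_mulmx Sc); apply: cvg_invmx.
  exact: (cvg_mulmx STc Sc).
by have [] := nbhs_singleton nS.
Unshelve. all: by end_near.
Qed.

End Projection.

(** * Locally bounded, strongly continuous families of linear maps *)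

Section StrongContinuity.
Variable R : realType.

(* A linear subspace [sn_dom] of an ambient module, with a function that is a
   seminorm on that subspace only: [supn] is junk outside [ell0]. *)
Record snspace := SnSpace {
  sn_sort :> lmodType R;
  sn_dom : set sn_sort;
  sn_norm : sn_sort -> R;
  sn_dom0 : sn_dom 0;
  sn_domL : forall (a : R) x y, sn_dom x -> sn_dom y -> sn_dom (a *: x + y);
  sn_norm0 : sn_norm 0 = 0;
  sn_ge0 : forall x, sn_dom x -> 0 <= sn_norm x;
  sn_normL : forall (a : R) x y, sn_dom x -> sn_dom y ->
    sn_norm (a *: x + y) <= `|a| * sn_norm x + sn_norm y }.

Section Theory.
Variable A : snspace.
Implicit Types x y : A.

Lemma sn_domD x y : sn_dom x -> sn_dom y -> sn_dom (x + y).
Proof. by move=> *; rewrite -[x]scale1r; exact: sn_domL. Qed.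

Lemma sn_domB x y : sn_dom x -> sn_dom y -> sn_dom (x - y).
Proof. by move=> *; rewrite addrC -scaleN1r; exact: sn_domL. Qed.

Lemma sn_domZ (a : R) x : sn_dom x -> sn_dom (a *: x).
Proof. by move=> ?; rewrite -[_ *: _]addr0; apply: sn_domL => //; exact: sn_dom0. Qed.

Lemma sn_normD x y : sn_dom x -> sn_dom y -> sn_norm (x + y) <= sn_norm x + sn_norm y.
Proof.
by move=> dx dy; have := sn_normL 1 dx dy; rewrite scale1r normr1 mul1r.
Qed.

Lemma sn_normB x y : sn_dom x -> sn_dom y -> sn_norm (x - y) <= sn_norm x + sn_norm y.
Proof.
move=> dx dy; have := sn_normL (-1) dy dx.
by rewrite scaleN1r normrN normr1 mul1r addrC [leRHS]addrC.
Qed.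

End Theory.

Section Prod.
Variables A B : snspace.

Definition prod_dom : set (A * B)%type := [set p | sn_dom p.1 /\ sn_dom p.2].

Lemma prod_dom0 : prod_dom 0. Proof. by split; exact: sn_dom0. Qed.

Lemma prod_domL (a : R) x y : prod_dom x -> prod_dom y -> prod_dom (a *: x + y).
Proof. by move=> [? ?] [? ?]; split; exact: sn_domL. Qed.

Lemma prod_ge0 x : prod_dom x -> 0 <= nsum (@sn_norm A) (@sn_norm B) x.
Proof. by move=> [? ?]; rewrite /nsum le_max sn_ge0. Qed.

Lemma prod_normL (a : R) x y : prod_dom x -> prod_dom y ->
  nsum (@sn_norm A) (@sn_norm B) (a *: x + y) <=
  `|a| * nsum (@sn_norm A) (@sn_norm B) x + nsum (@sn_norm A) (@sn_norm B) y.
Proof.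
move=> [x1 x2] [y1 y2]; rewrite /nsum ge_max; apply/andP; split.
- rewrite (le_trans (sn_normL a x1 y1))// lerD//; last by rewrite le_max lexx.
  by rewrite ler_wpM2l// le_max lexx.
- rewrite (le_trans (sn_normL a x2 y2))// lerD//; last by rewrite le_max lexx orbT.
  by rewrite ler_wpM2l// le_max lexx orbT.
Qed.

Lemma prod_norm0 : nsum (@sn_norm A) (@sn_norm B) 0 = 0.
Proof. by rewrite /nsum /= !sn_norm0 maxxx. Qed.

Definition sn_prod := SnSpace prod_dom0 prod_domL prod_norm0 prod_ge0 prod_normL.

End Prod.

Lemma vec_normL n (a : R) (x y : 'cV[R]_n) : setT x -> setT y ->
  `|a *: x + y| <= `|a| * `|x| + `|y|.
Proof. by move=> _ _; rewrite -normrZ ler_normD. Qed.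

Definition sn_vec n : snspace :=
  @SnSpace 'cV[R]_n setT (fun v => `|v|) I (fun _ _ _ _ _ => I) (normr0 _)
    (fun x _ => normr_ge0 x) (@vec_normL n).

Variable Lam : metricType R.

(** A local uniform bound together with pointwise convergence already implies continuity on the
    total space of a bundle ([scont_tot]), and it is stable under composition, sums and pairing, so
    that the bundle maps can be assembled from small pieces. *)
Definition scont (A B : snspace) (f : Lam -> A -> B) : Prop :=
  [/\ forall l x, sn_dom x -> sn_dom (f l x),
      forall l (a : R) x y, sn_dom x -> sn_dom y ->
        f l (a *: x + y) = a *: f l x + f l y,
      forall l : Lam, exists2 C : R, 0 <= C &
        \forall m \near l, forall x, sn_dom x -> sn_norm (f m x) <= C * sn_norm x &
      forall l x, sn_dom x -> forall e : R, 0 < e ->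
        \forall m \near l, sn_norm (f m x - f l x) < e].

Lemma scontB (A B : snspace) (f : Lam -> A -> B) l x y :
  scont f -> sn_dom x -> sn_dom y -> f l (x - y) = f l x - f l y.
Proof.
by case=> _ fL _ _ dx dy; rewrite addrC -scaleN1r fL// scaleN1r addrC.
Qed.

(** Split [f m y - f l x] as [f m (y - x) + (f m x - f l x)]: the local bound controls the first
    term, strong continuity at [x] the second. *)
Lemma scont_tot (A B : snspace) (f : Lam -> A -> B) (E : Lam -> set A) :
  scont f -> (forall l x, E l x -> sn_dom x) ->
  tot_continuous (@sn_norm A) (@sn_norm B) E f.
Proof.
move=> fc Ed l x Elx e e0; have dx := Ed _ _ Elx.
have [fd _ fb fs] := fc.
have [C C0 nC] := fb l.
have e2 : 0 < e / 2 by rewrite divr_gt0.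
have /nbhs_ballP[r /= r0 Hr] : \forall m \near l,
    (forall x, sn_dom x -> sn_norm (f m x) <= C * sn_norm x) /\
    sn_norm (f m x - f l x) < e / 2.
  by apply: filterS2 nC (fs l x dx _ e2) => m.
have C1 : 0 < C + 1 by rewrite ltr_wpDl.
(* [C] may be 0, hence the denominator [C + 1]. *)
exists (Num.min r (e / 2 / (C + 1))); split.
  by rewrite lt_min r0 divr_gt0.
move=> m y /Ed dy lm yx.
have [Hb Hs] : (forall x, sn_dom x -> sn_norm (f m x) <= C * sn_norm x) /\
    sn_norm (f m x - f l x) < e / 2.
  by apply: Hr; apply: le_ball lm; rewrite ge_min lexx.
have dyx := sn_domB dy dx.
have -> : f m y - f l x = f m (y - x) + (f m x - f l x).
  by rewrite scontB// addrA subrK.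
apply: (le_lt_trans (sn_normD _ _)).
- exact: fd.
- by apply: sn_domB; exact: fd.
rewrite [ltRHS](splitr e) ltr_leD//; last exact: ltW.
apply: (le_lt_trans (Hb _ dyx)).
move: yx; rewrite lt_min => /andP[_]; rewrite ltr_pdivlMr// mulrDr mulr1 mulrC.
by apply: le_lt_trans; rewrite lerDl sn_ge0.
Qed.

Lemma scont_comp (A B C : snspace) (f : Lam -> A -> B) (g : Lam -> B -> C) :
  scont f -> scont g -> scont (fun l x => g l (f l x)).
Proof.
move=> [fd fL fb fs] gc; have [gd gL gb gs] := gc; split.
- by move=> l x dx; exact/gd/fd.
- by move=> l a x y dx dy; rewrite fL// gL//; exact: fd.
- move=> l; have [c c0 nc] := fb l; have [k k0 nk] := gb l.
  exists (k * c); first exact: mulr_ge0.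
  apply: filterS2 nc nk => m Hc Hk x dx.
  rewrite (le_trans (Hk _ (fd _ _ dx)))// -mulrA ler_wpM2l//; exact: Hc.
move=> l x dx e e0; have [k k0 nk] := gb l.
have e2 : 0 < e / 2 by rewrite divr_gt0.
have k1 : 0 < k + 1 by rewrite ltr_wpDl.
have e3 : 0 < e / 2 / (k + 1) by rewrite divr_gt0.
apply: filterS3 nk (fs l x dx _ e3) (gs l _ (fd l _ dx) _ e2) => m Hk Hf Hg.
have dB : sn_dom (f m x - f l x) by apply: sn_domB; exact: fd.
have -> : g m (f m x) - g l (f l x) = g m (f m x - f l x) + (g m (f l x) - g l (f l x)).
  by rewrite (scontB _ gc) ?addrA ?subrK//; exact: fd.
apply: (le_lt_trans (sn_normD _ _)); first exact: gd.
  by apply: sn_domB; exact/gd/fd.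
rewrite [ltRHS](splitr e) ltr_leD//; last exact: ltW.
apply: (le_lt_trans (Hk _ dB)).
move: Hf; rewrite ltr_pdivlMr// mulrDr mulr1 mulrC.
by apply: le_lt_trans; rewrite lerDl sn_ge0.
Qed.

Lemma scontD (A B : snspace) (f g : Lam -> A -> B) :
  scont f -> scont g -> scont (fun l x => f l x + g l x).
Proof.
move=> [fd fL fb fs] [gd gL gb gs]; split.
- by move=> l x dx; apply: sn_domD; [exact: fd|exact: gd].
- by move=> l a x y dx dy; rewrite fL// gL// scalerDr addrACA.
- move=> l; have [c c0 nc] := fb l; have [k k0 nk] := gb l.
  exists (c + k); first exact: addr_ge0.
  apply: filterS2 nc nk => m Hc Hk x dx.
  rewrite (le_trans (sn_normD (fd _ _ dx) (gd _ _ dx)))// mulrDl.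
  by apply: lerD; [exact: Hc|exact: Hk].
move=> l x dx e e0.
have e2 : 0 < e / 2 by rewrite divr_gt0.
apply: filterS2 (fs l x dx _ e2) (gs l x dx _ e2) => m Hf Hg.
rewrite opprD addrACA.
apply: (le_lt_trans (sn_normD _ _)).
- by apply: sn_domB; exact: fd.
- by apply: sn_domB; exact: gd.
by rewrite [ltRHS](splitr e) ltrD.
Qed.

Lemma scont_sub (A B : snspace) (f g : Lam -> A -> B) :
  scont f -> scont g -> scont (fun l x => f l x - g l x).
Proof.
move=> [fd fL fb fs] [gd gL gb gs]; split.
- by move=> l x dx; apply: sn_domB; [exact: fd|exact: gd].
- by move=> l a x y dx dy; rewrite fL// gL// scalerBr opprD addrACA.
- move=> l; have [c c0 nc] := fb l; have [k k0 nk] := gb l.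
  exists (c + k); first exact: addr_ge0.
  apply: filterS2 nc nk => m Hc Hk x dx.
  rewrite (le_trans (sn_normB (fd _ _ dx) (gd _ _ dx)))// mulrDl.
  by apply: lerD; [exact: Hc|exact: Hk].
move=> l x dx e e0.
have e2 : 0 < e / 2 by rewrite divr_gt0.
apply: filterS2 (fs l x dx _ e2) (gs l x dx _ e2) => m Hf Hg.
have -> : f m x - g m x - (f l x - g l x) = (f m x - f l x) - (g m x - g l x).
  by rewrite !opprB addrACA [RHS]addrACA [- g m x - _]addrC.
apply: (le_lt_trans (sn_normB _ _)).
- by apply: sn_domB; exact: fd.
- by apply: sn_domB; exact: gd.
by rewrite [ltRHS](splitr e) ltrD.
Qed.

Lemma scont_pair (A B C : snspace) (f : Lam -> A -> B) (g : Lam -> A -> C) :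
  scont f -> scont g -> scont (B := sn_prod B C) (fun l x => (f l x, g l x)).
Proof.
move=> [fd fL fb fs] [gd gL gb gs]; split.
- by move=> l x dx; split; [exact: fd|exact: gd].
- by move=> l a x y dx dy; rewrite fL// gL.
- move=> l; have [c c0 nc] := fb l; have [k k0 nk] := gb l.
  exists (Num.max c k); first by rewrite le_max c0.
  apply: filterS2 nc nk => m Hc Hk x dx.
  rewrite /= /nsum ge_max; apply/andP; split.
    by rewrite (le_trans (Hc _ dx))// ler_wpM2r ?sn_ge0// le_max lexx.
  by rewrite (le_trans (Hk _ dx))// ler_wpM2r ?sn_ge0// le_max lexx orbT.
move=> l x dx e e0.
apply: filterS2 (fs l x dx _ e0) (gs l x dx _ e0) => m Hf Hg.
by rewrite /= /nsum gt_max Hf.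
Qed.

Lemma scont_cst (A B : snspace) (f : A -> B) (C : R) : 0 <= C ->
  (forall x, sn_dom x -> sn_dom (f x)) ->
  (forall (a : R) x y, sn_dom x -> sn_dom y -> f (a *: x + y) = a *: f x + f y) ->
  (forall x, sn_dom x -> sn_norm (f x) <= C * sn_norm x) ->
  scont (fun _ => f).
Proof.
move=> C0 fd fL fb; split => //; first by move=> l; exists C => //; exact: nearW.
move=> l x dx e e0; apply: nearW => m; rewrite subrr.
by rewrite sn_norm0.
Qed.

Lemma scont_fst (A B : snspace) : scont (A := sn_prod A B) (fun _ p => p.1).
Proof.
apply: (@scont_cst (sn_prod A B) A _ 1) => //; first by move=> x [].
by move=> x dx; rewrite mul1r /= /nsum le_max lexx.
Qed.

Lemma scont_snd (A B : snspace) : scont (A := sn_prod A B) (fun _ p => p.2).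
Proof.
apply: (@scont_cst (sn_prod A B) B _ 1) => //; first by move=> x [].
by move=> x dx; rewrite mul1r /= /nsum le_max lexx orbT.
Qed.

Lemma cvg_norm_bounded n p (P : Lam -> 'M[R]_(n, p)) (l : Lam) : continuous P ->
  \forall m \near l, `|P m| <= `|P l| + 1.
Proof.
move=> Pc; move/cvgrPdist_lt : (Pc l) => /(_ 1 ltr01); apply: filterS => m Hm.
rewrite -[P m](subrK (P l)) addrC (le_trans (ler_normD _ _))// lerD2l.
by rewrite distrC ltW.
Qed.

Lemma scont_mx n p (P : Lam -> 'M[R]_(n, p)) : continuous P ->
  scont (A := sn_vec p) (B := sn_vec n) (fun l x => P l *m x).
Proof.
move=> Pc; split => //.
- by move=> l a x y _ _; rewrite mulmxDr scalemxAr.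
- move=> l; exists (p%:R * (`|P l| + 1)); first by rewrite mulr_ge0// addr_ge0.
  apply: filterS (cvg_norm_bounded l Pc) => m Hm x _ /=.
  by rewrite (le_trans (mx_norm_mul _ _))// ler_wpM2r// ler_wpM2l.
move=> l x _ e e0 /=.
have H : P m *m x @[m --> l] --> P l *m x.
  by apply: cvg_mulmx; [exact: Pc|exact: cvg_cst].
move/cvgrPdist_lt : H => /(_ e e0).
by apply: filterS => m; rewrite distrC.
Qed.

End StrongContinuity.

(** * The space of null sequences and the two scalar recursions *)

Section SequenceSpace.
Variables (R : realType) (d : nat).
Local Notation seqd := (seqd R d).
Local Notation ell0 := (@ell0 R d).
Implicit Types (phi psi u : seqd) (n : int) (c e : R).

Lemma ell0P phi : ell0 phi <-> forall e, 0 < e ->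
  exists N : nat, forall n, (N <= `|n|)%N -> `|phi n| < e.
Proof.
split=> H e /H[M HM]; first by exists `|M|%N => n nM; apply: HM; lia.
by exists M%:Z => n nM; apply: HM; lia.
Qed.

(** Far out the bound is 1. The remaining indices are [i] or [- i] with [i < N], and the sum of all
    their norms dominates each of them. Boundedness is what makes [supn] a genuine supremum on
    [ell0]. *)
Lemma ell0_bounded phi : ell0 phi -> exists c, forall n, `|phi n| <= c.
Proof.
move=> /ell0P/(_ 1 ltr01)[N HN].
pose f (i : 'I_N) := `|phi i%:Z| + `|phi (- i%:Z)|.
have f0 i : 0 <= f i by rewrite addr_ge0.
exists (1 + \sum_i f i) => n.
have [nN|nN] := leqP N `|n|.
  by rewrite (le_trans (ltW (HN _ nN)))// lerDl sumr_ge0.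
rewrite ler_wpDl// (bigD1 (Ordinal nN))//= ler_wpDr ?sumr_ge0// /f /=.
have [->|->] : n = `|n|%N :> int \/ n = - (`|n|%N%:Z) by lia.
  by rewrite absz_nat lerDl.
by rewrite abszN absz_nat lerDr.
Qed.

Lemma supn_le phi c : (forall n, `|phi n| <= c) -> supn phi <= c.
Proof.
move=> H; apply: ge_sup; first by exists `|phi 0|, 0.
by move=> _ [n _ <-].
Qed.

Lemma supn_ub phi n : ell0 phi -> `|phi n| <= supn phi.
Proof.
move=> /ell0_bounded[c Hc]; apply: sup_upper_bound; last by exists n.
by split; [exists `|phi 0|, 0 | exists c => _ [m _ <-]].
Qed.

Lemma supn_ge0 phi : ell0 phi -> 0 <= supn phi.
Proof. by move=> /(supn_ub 0); exact: le_trans. Qed.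

Lemma ell0_0 : ell0 0.
Proof. by apply/ell0P => e e0; exists 0%N => n _; rewrite normr0. Qed.

Lemma ell0_lin (a : R) phi psi : ell0 phi -> ell0 psi -> ell0 (a *: phi + psi).
Proof.
move=> /ell0P p1 /ell0P p2; apply/ell0P => e e0.
have a1 : 0 < `|a| + 1 by rewrite ltr_wpDl.
have e1 : 0 < e / 2 / (`|a| + 1) by rewrite !divr_gt0.
have e2 : 0 < e / 2 by rewrite divr_gt0.
have [N1 H1] := p1 _ e1; have [N2 H2] := p2 _ e2.
exists (N1 + N2)%N => n nN.
rewrite -[(_ + _) n]/(a *: phi n + psi n).
rewrite (le_lt_trans (ler_normD _ _))// [ltRHS](splitr e) ler_ltD//; last first.
  by apply: H2; lia.
have : `|phi n| < e / 2 / (`|a| + 1) by apply: H1; lia.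
rewrite ltr_pdivlMr// normrZ => /ltW; apply: le_trans.
by rewrite mulrC ler_wpM2l// lerDl.
Qed.

Lemma supn0 : supn (0 : seqd) = 0.
Proof.
apply/eqP; rewrite eq_le supn_ge0 ?andbT; last exact: ell0_0.
by apply: supn_le => n; rewrite normr0.
Qed.

Lemma supn_lin (a : R) phi psi : ell0 phi -> ell0 psi ->
  supn (a *: phi + psi) <= `|a| * supn phi + supn psi.
Proof.
move=> p1 p2; apply: supn_le => n; rewrite -[(_ + _) n]/(a *: phi n + psi n).
by rewrite (le_trans (ler_normD _ _))// normrZ lerD ?ler_wpM2l// supn_ub.
Qed.

Definition sn_ell0 : snspace R :=
  SnSpace ell0_0 ell0_lin supn0 supn_ge0 supn_lin.

Lemma ell0_le phi psi c : ell0 phi -> 0 <= c ->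
  (forall n, `|psi n| <= c * `|phi n|) -> ell0 psi.
Proof.
move=> /ell0P p1 c0 H; apply/ell0P => e e0.
have c1 : 0 < c + 1 by rewrite ltr_wpDl.
have [N HN] := p1 _ (divr_gt0 e0 c1); exists N => n /HN.
rewrite ltr_pdivlMr// mulrDr mulr1 mulrC; apply: le_lt_trans.
by rewrite (le_trans (H n))// lerDl.
Qed.

Lemma ell0_shift phi (k : int) : ell0 phi -> ell0 (fun n => phi (n + k)).
Proof.
move=> /ell0P p1; apply/ell0P => e /p1[N HN].
by exists (N + `|k|)%N => n nN; apply: HN; lia.
Qed.

Lemma ell0_reflect phi (k : int) : ell0 phi -> ell0 (fun n => phi (k - n)).
Proof.
move=> /ell0P p1; apply/ell0P => e /p1[N HN].
by exists (N + `|k|)%N => n nN; apply: HN; lia.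
Qed.

Lemma half_series_cvg (s : nat -> R) c : (forall j, `|s j| <= c) ->
  cvgn (series (fun j => 2^-1 ^+ j * s j)).
Proof.
move=> sc; apply: normed_cvg.
apply: (@series_le_cvg _ _ (geometric c 2^-1)) => [j|j|j|].
- exact: normr_ge0.
- by rewrite /geometric /= mulr_ge0// ?exprn_ge0// (le_trans _ (sc 0%N)).
- by rewrite /geometric /= normrM normrX ger0_norm// mulrC ler_wpM2r// exprn_ge0.
apply: is_cvg_geometric_series; rewrite ger0_norm//; lra.
Qed.

Lemma half_series_le (s : nat -> R) c : (forall j, `|s j| <= c) ->
  `|limn (series (fun j => 2^-1 ^+ j * s j))| <= 2 * c.
Proof.
move=> sc; have sv := half_series_cvg sc.
have c0 : 0 <= c := le_trans (normr_ge0 _) (sc 0%N).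
(* The remainder [2 * c * 2^-1 ^+ k] is kept in the bound so that the induction closes. *)
have bound k : `|series (fun j => 2^-1 ^+ j * s j) k| <= 2 * c - 2 * c * 2^-1 ^+ k.
  elim: k => [|k IH]; first by rewrite /series /= big_geq// normr0 expr0; lra.
  rewrite /series /= big_nat_recr//= (le_trans (ler_normD _ _))//.
  have h : `|2^-1 ^+ k * s k| <= 2^-1 ^+ k * c.
    by rewrite normrM normrX ger0_norm// ler_wpM2l// exprn_ge0.
  rewrite exprS; move: IH; rewrite /series /=; lra.
rewrite -lim_norm//; apply: limr_le; first exact: is_cvg_norm.
apply: nearW => k; by rewrite (le_trans (bound k))// gerBl !mulr_ge0.
Qed.

Lemma half_series_rec (s : nat -> R) c : (forall j, `|s j| <= c) ->
  limn (series (fun j => 2^-1 ^+ j * s j)) =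
  s 0%N + 2^-1 * limn (series (fun j => 2^-1 ^+ j * s j.+1)).
Proof.
move=> sc; have sv := half_series_cvg sc.
have sv1 := @half_series_cvg (s \o succn) c (fun j => sc j.+1).
apply: cvg_lim => //.
rewrite -(cvg_shiftS (series _)) /=.
have -> : (fun k => series (fun j => 2^-1 ^+ j * s j) k.+1) =
    (fun k => s 0%N + 2^-1 * series (fun j => 2^-1 ^+ j * (s \o succn) j) k).
  apply/funext => k; rewrite /series /= big_nat_recl//= expr0 mul1r; congr (_ + _).
  by rewrite mulr_sumr; apply: eq_bigr => j _; rewrite exprS mulrA.
by apply: cvgD; [exact: cvg_cst|apply: cvgM => //; exact: cvg_cst].
Qed.

(** The solution is the convolution [u n = \sum_j 2^-j psi (n - 1 - j)], taken coordinate by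
    coordinate. Decay to the left holds because [u n] only sees values of [psi] further left; decay
    to the right comes from iterating the recursion from a point beyond which [psi] is small. *)
Lemma ell0_half_ex psi : ell0 psi ->
  exists u, ell0 u /\ forall n, u (n + 1) = 2^-1 *: u n + psi n.
Proof.
move=> psi0; have [c Hc] := ell0_bounded psi0.
pose s n i j := psi (n - 1 - j%:Z) i 0.
have sc n i j : `|s n i j| <= c by rewrite (le_trans (mx_norm_entry _ _ _)).
pose u n := \col_(i < d) limn (series (fun j => 2^-1 ^+ j * s n i j)) : 'cV[R]_d.
have urec n : u (n + 1) = 2^-1 *: u n + psi n.
  apply/matrixP => i k; rewrite ord1 !mxE (half_series_rec (sc (n + 1) i)) [LHS]addrC.
  congr (_ * _ + psi _ i 0); last by lia.
  congr (limn (series _)); apply/funext => j; congr (_ * psi _ i 0); lia.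
have ub n e : 0 <= e -> (forall j : nat, `|psi (n - 1 - j%:Z)| <= e) -> `|u n| <= 2 * e.
  move=> e0 He; apply: mx_norm_le => [|i k]; first by rewrite mulr_ge0.
  rewrite mxE; apply: half_series_le => j.
  exact: le_trans (mx_norm_entry _ _ _) (He j).
have c0 : 0 <= c := le_trans (normr_ge0 _) (Hc 0).
have uc n : `|u n| <= 2 * c by exact: ub.
exists u; split => //; apply/ell0P => e e0.
have e4 : 0 < e / 4 by rewrite divr_gt0.
have [N HN] := (ell0P _).1 psi0 _ e4.
(* [e / 2] is the fixed point of [t = t / 2 + e / 4], so each step preserves this term and halves
   the other one. *)
have up (k : nat) : `|u (N%:Z + k%:Z)| <= 2 * c * 2^-1 ^+ k + e / 2.
  elim: k => [|k IH]; first by rewrite expr0 addr0 mulr1 ler_wpDr// divr_ge0// ltW.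
  have -> : N%:Z + k.+1%:Z = N%:Z + k%:Z + 1 by lia.
  rewrite urec (le_trans (ler_normD _ _))// normrZ ger0_norm//.
  have : `|psi (N%:Z + k%:Z)| < e / 4 by apply: HN; lia.
  rewrite exprS; lra.
have [K HK] : exists K, forall k, (K <= k)%N -> 2 * c * 2^-1 ^+ k < e / 2.
  have h : `|2^-1 : R| < 1 by rewrite ger0_norm//; lra.
  have e2 : 0 < e / 2 by rewrite divr_gt0.
  have /cvgrPdist_lt/(_ _ e2)[K _ HK] := cvg_geometric (2 * c) h.
  exists K => k Kk; have := HK k Kk; rewrite sub0r normrN /geometric /=.
  by apply: le_lt_trans; exact: ler_norm.
exists (N + K)%N => n nN.
have [n0|n0] := lerP 0 n.
  have -> : n = N%:Z + (`|n| - N)%N%:Z by lia.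
  have h : (K <= `|n| - N)%N by lia.
  by have := HK _ h; have := up (`|n| - N)%N; lra.
apply: (@le_lt_trans _ _ (2 * (e / 4))); last by lra.
apply: ub; first exact: ltW.
by move=> j; apply/ltW/HN; lia.
Qed.

(** Time reversal [n -> - n] turns doubling into halving, with the source [psi] reflected about -1/2
    and multiplied by -1/2. *)
Lemma ell0_double_ex psi : ell0 psi ->
  exists u, ell0 u /\ forall n, u (n + 1) = 2 *: u n + psi n.
Proof.
move=> psi0.
have [u [u0 uR]] : exists u, ell0 u /\
    forall n, u (n + 1) = 2^-1 *: u n + - 2^-1 *: psi (-1 - n).
  apply: (@ell0_half_ex (fun n => - 2^-1 *: psi (-1 - n))).
  apply: (ell0_le (ell0_reflect (-1) psi0) (c := 2^-1)) => // n.
  by rewrite normrZ normrN ger0_norm.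
exists (fun n => u (0 - n)); split; first exact: ell0_reflect.
move=> n; have -> : 0 - n = 0 - (n + 1) + 1 :> int by lia.
rewrite uR scalerDr !scalerA mulfV// mulrN mulfV// scale1r scaleN1r.
by have -> : -1 - (0 - (n + 1)) = n :> int; [lia|rewrite subrK].
Qed.

(** The operators are pinned down by the equation alone: linearity and bounds follow from uniqueness
    and an a priori estimate, without the series. The default 0 of [xget] is not reached for [psi]
    in [ell0], where a solution exists. *)
Definition Uop psi : seqd :=
  xget 0 [set u | ell0 u /\ forall n, u (n + 1) = 2^-1 *: u n + psi n].
Definition Hop psi : seqd :=
  xget 0 [set u | ell0 u /\ forall n, u (n + 1) = 2 *: u n + psi n].

Lemma UopP psi : ell0 psi -> ell0 (Uop psi) /\
  forall n, Uop psi (n + 1) = 2^-1 *: Uop psi n + psi n.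
Proof. by move=> /ell0_half_ex H; exact: (xgetPex 0 H). Qed.

Lemma HopP psi : ell0 psi -> ell0 (Hop psi) /\
  forall n, Hop psi (n + 1) = 2 *: Hop psi n + psi n.
Proof. by move=> /ell0_double_ex H; exact: (xgetPex 0 H). Qed.

(** The recursion bounds [supn u] by half of itself plus [supn psi], and the half is absorbed on the
    left. *)
Lemma half_apriori u psi : ell0 u -> ell0 psi ->
  (forall n, u (n + 1) = 2^-1 *: u n + psi n) -> supn u <= 2 * supn psi.
Proof.
move=> u0 p0 uR; suff : supn u <= 2^-1 * supn u + supn psi by lra.
apply: supn_le => n; rewrite -[n](subrK 1) uR (le_trans (ler_normD _ _))//.
by rewrite normrZ ger0_norm// lerD ?ler_wpM2l// supn_ub.
Qed.

(** The same absorption after solving the recursion for [u n] in terms of [u (n + 1)]; both terms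
    now carry 1/2, hence the constant 1. *)
Lemma double_apriori u psi : ell0 u -> ell0 psi ->
  (forall n, u (n + 1) = 2 *: u n + psi n) -> supn u <= supn psi.
Proof.
move=> u0 p0 uR; suff : supn u <= 2^-1 * supn u + 2^-1 * supn psi by lra.
apply: supn_le => n.
have -> : u n = 2^-1 *: u (n + 1) - 2^-1 *: psi n.
  by rewrite uR scalerDr scalerA mulVf// scale1r addrK.
rewrite (le_trans (ler_normB _ _))// !normrZ ger0_norm//.
by rewrite lerD ?ler_wpM2l// supn_ub.
Qed.

Lemma supn_eq0 phi : ell0 phi -> supn phi <= 0 -> phi = 0.
Proof.
move=> p0 s0; apply/funext => n; apply/eqP; rewrite -normr_le0.
exact: le_trans (supn_ub _ p0) s0.
Qed.

Lemma half_unique u psi : ell0 u -> ell0 psi ->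
  (forall n, u (n + 1) = 2^-1 *: u n + psi n) -> u = Uop psi.
Proof.
move=> u0 p0 uR; have [U0 UR] := UopP p0.
have D0 : ell0 (u - Uop psi) by exact: (@sn_domB _ sn_ell0).
apply/eqP; rewrite -subr_eq0; apply/eqP/supn_eq0 => //.
have := half_apriori D0 ell0_0; rewrite supn0 mulr0; apply => n.
rewrite -[(_ - _) (n + 1)]/(u (n + 1) - Uop psi (n + 1)).
rewrite -[(_ - _) n]/(u n - Uop psi n) uR UR addr0 scalerBr opprD.
by rewrite addrACA subrr addr0.
Qed.

Lemma double_unique u psi : ell0 u -> ell0 psi ->
  (forall n, u (n + 1) = 2 *: u n + psi n) -> u = Hop psi.
Proof.
move=> u0 p0 uR; have [U0 UR] := HopP p0.
have D0 : ell0 (u - Hop psi) by exact: (@sn_domB _ sn_ell0).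
apply/eqP; rewrite -subr_eq0; apply/eqP/supn_eq0 => //.
have := double_apriori D0 ell0_0; rewrite supn0; apply => n.
rewrite -[(_ - _) (n + 1)]/(u (n + 1) - Hop psi (n + 1)).
rewrite -[(_ - _) n]/(u n - Hop psi n) uR UR addr0 scalerBr opprD.
by rewrite addrACA subrr addr0.
Qed.

(** By uniqueness: the combination of two solutions solves the combined equation. *)
Lemma Uop_lin (a : R) phi psi : ell0 phi -> ell0 psi ->
  Uop (a *: phi + psi) = a *: Uop phi + Uop psi.
Proof.
move=> p1 p2; have [U1 R1] := UopP p1; have [U2 R2] := UopP p2.
apply/esym/half_unique; [exact: ell0_lin|exact: ell0_lin|move=> n].
rewrite -[LHS]/(a *: Uop phi (n + 1) + Uop psi (n + 1)).
rewrite -[RHS]/(2^-1 *: (a *: Uop phi n + Uop psi n) + (a *: phi n + psi n)).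
by rewrite R1 R2 !scalerDr !scalerA (mulrC a) addrACA.
Qed.

Lemma Hop_lin (a : R) phi psi : ell0 phi -> ell0 psi ->
  Hop (a *: phi + psi) = a *: Hop phi + Hop psi.
Proof.
move=> p1 p2; have [U1 R1] := HopP p1; have [U2 R2] := HopP p2.
apply/esym/double_unique; [exact: ell0_lin|exact: ell0_lin|move=> n].
rewrite -[LHS]/(a *: Hop phi (n + 1) + Hop psi (n + 1)).
rewrite -[RHS]/(2 *: (a *: Hop phi n + Hop psi n) + (a *: phi n + psi n)).
by rewrite R1 R2 !scalerDr !scalerA (mulrC a) addrACA.
Qed.

End SequenceSpace.

(** * Local frames for the image of a continuous family of projections *)

Section Frames.
Variables (R : realType) (Lam : metricType R).

Lemma scont_sum (A B : snspace R) (f : Lam -> A -> B) l k (c : 'I_k -> R) (x : 'I_k -> A) :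
  scont f -> (forall i, sn_dom (x i)) ->
  f l (\sum_i c i *: x i) = \sum_i c i *: f l (x i).
Proof.
move=> fc dx; have [_ fL _ _] := fc.
suff [] : sn_dom (\sum_i c i *: x i) /\ f l (\sum_i c i *: x i) = \sum_i c i *: f l (x i) by [].
elim/big_ind2 : _ => [|y' y z' z [dy <-] [dz <-]|i _].
- split; first exact: sn_dom0.
  by have := scontB l fc (sn_dom0 A) (sn_dom0 A); rewrite !subrr.
- split; first exact: sn_domD.
  by rewrite -[y]scale1r fL// !scale1r.
split; first exact: sn_domZ.
have := fL l (c i) _ _ (dx i) (sn_dom0 A); rewrite addr0 => ->.
have := scontB l fc (sn_dom0 A) (sn_dom0 A); rewrite !subrr => ->.
by rewrite addr0.
Qed.

(** The matrix [K l] is the identity at [l0], hence invertible nearby, and it intertwines [Pi l0]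
    with [Pi l]. So it carries a basis [b] of the range of [Pi l0] to a basis of the range of
    [Pi l], and [Psi l], injective there, carries that one to a frame. On [b], [K l] acts as
    [Pi l]. *)
Lemma bundle_of_proj n (Pi : Lam -> 'M[R]_n) (A : snspace R)
    (Psi : Lam -> sn_vec R n -> A) :
  continuous Pi -> (forall l, Pi l *m Pi l = Pi l) -> scont Psi ->
  (forall l (x : 'cV[R]_n), Pi l *m x = x -> Psi l x = 0 -> x = 0) ->
  is_bundle (@sn_norm R A)
    (fun l => [set Psi l x | x in [set x : 'cV[R]_n | Pi l *m x = x]]).
Proof.
move=> Pic Pi2 Psic Psi_inj; have [_ PsiL _ _] := Psic; split.
  move=> l; split.
    exists 0 => /=; first by rewrite mulmx0.
    by have := scontB l Psic I I (x := 0) (y := 0); rewrite !subrr.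
  move=> a _ _ [x /= Px <-] [y /= Py <-]; exists (a *: x + y) => /=.
    by rewrite mulmxDr -scalemxAr Px Py.
  exact: PsiL.
move=> l0.
have [k [b [sb ib]]] := span_indep (fun j : 'I_n => col j (Pi l0)).
have spanE x : Defs.span b x <-> Pi l0 *m x = x.
  rewrite sb; split => [[c ->]|<-].
    rewrite mulmx_sumr; apply: eq_bigr => j _.
    by rewrite -scalemxAr !colE mulmxA Pi2.
  exists (fun j => x j 0); apply/matrixP => i j.
  rewrite mxE summxE; apply: eq_bigr => h _.
  by rewrite !mxE ord1 mulrC.
have Pib i : Pi l0 *m b i = b i.
  apply/spanE; exists (fun j => (j == i)%:R); rewrite (bigD1 i)//= eqxx scale1r.
  by rewrite big1 ?addr0// => j /negbTE ->; rewrite scale0r.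
pose K l := Pi l *m Pi l0 + (1%:M - Pi l) *m (1%:M - Pi l0).
have K0 : K l0 = 1%:M.
  by rewrite /K mulmxBl mul1mx mulmxBr mulmx1 Pi2 subrr subr0 addrC subrK.
have Kc : K l @[l --> l0] --> K l0.
  apply: cvgD; apply: cvg_mulmx; [exact: Pic|exact: cvg_cst| |exact: cvg_cst].
  by apply: cvgB; [exact: cvg_cst|exact: Pic].
have /nbhs_ballP[r /= r0 Kr] : \forall l \near l0, K l \in unitmx.
  by apply: (cvg_unitmx Kc); rewrite K0 unitmx1.
have Kb l i : K l *m b i = Pi l *m b i.
  by rewrite mulmxDl -!mulmxA (mulmxBl _ (Pi l0)) mul1mx Pib subrr mulmx0 addr0.
have KP l : K l *m Pi l0 = Pi l *m K l.
  have h1 : (1%:M - Pi l0) *m Pi l0 = 0 by rewrite mulmxBl mul1mx Pi2 subrr.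
  have h2 : Pi l *m (1%:M - Pi l) = 0 by rewrite mulmxBr mulmx1 Pi2 subrr.
  rewrite [LHS]mulmxDl [RHS]mulmxDr -(mulmxA _ _ (Pi l0)) -(mulmxA _ _ (Pi l0)) h1.
  by rewrite Pi2 mulmx0 !mulmxA h2 mul0mx Pi2.
exists k, (fun i l => Psi l (Pi l *m b i)), r; split => //; split.
  move=> i l _ e e0.
  have [_ _ _ /(_ l (b i) I e e0)] := scont_comp (scont_mx Pic) Psic.
  move=> /nbhs_ballP[eta /= eta0 H]; exists eta; split => // m _ lm.
  exact: H.
move=> l /Kr uK; split => [i|_ [y /= Py <-]].
  by exists (Pi l *m b i) => //=; rewrite mulmxA Pi2.
have [c yc] : Defs.span b (invmx (K l) *m y).
  apply/spanE; rewrite -{2}Py; apply: (can_inj (mulKmx uK)).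
  by rewrite mulmxA KP -mulmxA !mulKVmx.
have sumK (a : 'I_k -> R) : \sum_i a i *: (Pi l *m b i) = K l *m \sum_i a i *: b i.
  by rewrite mulmx_sumr; apply: eq_bigr => i _; rewrite -scalemxAr Kb.
have ysum : y = \sum_i c i *: (Pi l *m b i) by rewrite sumK -yc mulKVmx.
exists c; split; first by rewrite {1}ysum scont_sum.
move=> c' yc'; apply/funext => i; apply/eqP; rewrite -subr_eq0; apply/eqP.
apply: (ib (fun i => c i - c' i)); apply: (can_inj (mulKmx uK)).
rewrite -sumK mulmx0; apply: (Psi_inj l).
  rewrite mulmx_sumr; apply: eq_bigr => j _.
  by rewrite -scalemxAr mulmxA Pi2.
rewrite (scont_sum l (fun i => c i - c' i) Psic)//.
under eq_bigr do rewrite scalerBl.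
rewrite sumrB -yc' -(scont_sum l c Psic)// -ysum.
by rewrite subrr.
Qed.

End Frames.

(** * Building blocks: multiplication, shift, exponential decay, finite combinations *)

Section Operators.
Variables (R : realType) (d : nat).
Local Notation seqd := (seqd R d).
Local Notation ell0 := (@ell0 R d).
Local Notation sn_ell0 := (sn_ell0 R d).

Definition signmx (A B : 'M[R]_d) (n : int) : 'M[R]_d := if 0 <= n then A else B.

Definition mulop (A B : 'M[R]_d) (phi : seqd) : seqd :=
  fun n => signmx A B n *m phi n.

Definition shiftop (phi : seqd) : seqd := fun n => phi (n + 1).

Definition decay (p : 'cV[R]_d * 'cV[R]_d) : seqd :=
  fun n => 2^-1 ^+ `|n|%N *: (if 0 <= n then p.1 else p.2).

Definition comb k (b : 'I_k -> seqd) (c : 'cV[R]_k) : seqd :=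
  \sum_i c i 0 *: b i.

Lemma mulop_le A B phi n : `|mulop A B phi n| <= d%:R * (`|A| + `|B|) * `|phi n|.
Proof.
rewrite (le_trans (mx_norm_mul _ _))// ler_wpM2r// ler_wpM2l// /signmx.
by case: ifP; rewrite ?lerDl ?lerDr.
Qed.

Lemma mulop_ell0 A B phi : ell0 phi -> ell0 (mulop A B phi).
Proof.
move=> p0; apply: (ell0_le p0 _ (mulop_le A B phi)).
by rewrite mulr_ge0// addr_ge0.
Qed.

Lemma mulop_supn A B phi : ell0 phi ->
  supn (mulop A B phi) <= d%:R * (`|A| + `|B|) * supn phi.
Proof.
move=> p0; apply: supn_le => n; rewrite (le_trans (mulop_le _ _ _ _))//.
by rewrite ler_wpM2l ?supn_ub// mulr_ge0// addr_ge0.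
Qed.

Lemma mulop_sub A B A' B' phi :
  mulop A B phi - mulop A' B' phi = mulop (A - A') (B - B') phi.
Proof.
apply/funext => n; rewrite -[LHS]/(mulop A B phi n - mulop A' B' phi n).
by rewrite /mulop /signmx; case: ifP; rewrite mulmxBl.
Qed.

Lemma shiftop_supn phi : ell0 phi -> supn (shiftop phi) <= supn phi.
Proof. by move=> p0; apply: supn_le => n; exact: (supn_ub (n + 1) p0). Qed.

Lemma decay_le p (n : int) : `|decay p n| <= 2^-1 ^+ `|n|%N * Num.max `|p.1| `|p.2|.
Proof.
rewrite normrZ ger0_norm ?exprn_ge0// ler_wpM2l ?exprn_ge0//.
by case: ifP; rewrite le_max lexx ?orbT.
Qed.

Lemma decay_ell0 p : ell0 (decay p).
Proof.
apply/ell0P => e e0; set c := Num.max `|p.1| `|p.2|.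
have h : `|2^-1 : R| < 1 by rewrite ger0_norm//; lra.
have /cvgrPdist_lt/(_ _ e0)[K _ HK] := cvg_geometric c h.
exists K => n /HK; rewrite sub0r normrN /geometric /= => /(le_lt_trans (ler_norm _)).
by apply: le_lt_trans; rewrite mulrC decay_le.
Qed.

Variable Lam : metricType R.

Lemma scont_Uop : scont (Lam := Lam) (A := sn_ell0) (B := sn_ell0) (fun _ => @Uop R d).
Proof.
apply: (@scont_cst _ _ sn_ell0 sn_ell0 _ 2) => //.
- by move=> phi /UopP[].
- exact: Uop_lin.
- by move=> phi p0; have [U0 UR] := UopP p0; exact: half_apriori.
Qed.

Lemma scont_Hop : scont (Lam := Lam) (A := sn_ell0) (B := sn_ell0) (fun _ => @Hop R d).
Proof.
apply: (@scont_cst _ _ sn_ell0 sn_ell0 _ 1) => //.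
- by move=> phi /HopP[].
- exact: Hop_lin.
- by move=> phi p0; have [U0 UR] := HopP p0; rewrite mul1r; exact: double_apriori.
Qed.

Lemma scont_ev (n : int) :
  scont (Lam := Lam) (A := sn_ell0) (B := sn_vec R d) (fun _ phi => phi n).
Proof.
apply: (@scont_cst _ _ sn_ell0 (sn_vec R d) _ 1) => // phi p0.
by rewrite mul1r; exact: supn_ub.
Qed.

Lemma scont_shiftop : scont (Lam := Lam) (A := sn_ell0) (B := sn_ell0) (fun _ => shiftop).
Proof.
apply: (@scont_cst _ _ sn_ell0 sn_ell0 _ 1) => //.
- by move=> phi; exact: ell0_shift.
- by move=> phi p0; rewrite mul1r; exact: shiftop_supn.
Qed.

Lemma scont_decay :
  scont (Lam := Lam) (A := sn_prod (sn_vec R d) (sn_vec R d)) (B := sn_ell0) (fun _ => decay).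
Proof.
apply: (@scont_cst _ _ (sn_prod (sn_vec R d) (sn_vec R d)) sn_ell0 _ 1) => //.
- by move=> p _; exact: decay_ell0.
- move=> a p q _ _; apply/funext => n.
  rewrite -[RHS]/(a *: decay p n + decay q n) /decay.
  by case: ifP => _ /=; rewrite scalerDr !scalerA (mulrC a).
- move=> p _; rewrite mul1r; apply: supn_le => n.
  by rewrite (le_trans (decay_le _ _))// ler_piMl ?le_max ?normr_ge0// exprn_ile1//; lra.
Qed.

Lemma scont_comb k (b : 'I_k -> seqd) : (forall i, ell0 (b i)) ->
  scont (Lam := Lam) (A := sn_vec R k) (B := sn_ell0) (fun _ => comb b).
Proof.
move=> b0.
have b0' (i : 'I_k) : 0 <= supn (b i) by exact: supn_ge0.
apply: (@scont_cst _ _ (sn_vec R k) sn_ell0 _ (\sum_i supn (b i))).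
- exact: sumr_ge0.
- move=> c _; apply: (big_ind ell0); first exact: ell0_0.
    by move=> x y; exact: (@sn_domD _ sn_ell0).
  by move=> i _; apply: (@sn_domZ _ sn_ell0); exact: b0.
- move=> a c c' _ _; rewrite /comb scaler_sumr -big_split; apply: eq_bigr => i _.
  by rewrite !mxE scalerDl scalerA.
move=> c _; apply: supn_le => n.
rewrite /comb (_ : (\sum_i _) n = \sum_i c i 0 *: b i n); last first.
  by rewrite fct_sumE.
rewrite (le_trans (ler_norm_sum _ _ _))// mulr_suml; apply: ler_sum => i _.
by rewrite normrZ mulrC ler_pM// ?supn_ub// mx_norm_entry.
Qed.

Lemma scont_mulop (A B : Lam -> 'M[R]_d) : continuous A -> continuous B ->
  scont (A := sn_ell0) (B := sn_ell0) (fun l => mulop (A l) (B l)).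
Proof.
move=> Ac Bc; split.
- by move=> l phi; exact: mulop_ell0.
- move=> l a phi psi _ _; apply/funext => n.
  rewrite -[RHS]/(a *: mulop (A l) (B l) phi n + mulop (A l) (B l) psi n).
  by rewrite /mulop -[(_ + _) n]/(a *: phi n + psi n) mulmxDr scalemxAr.
- move=> l; exists (d%:R * ((`|A l| + 1) + (`|B l| + 1))).
    by rewrite mulr_ge0// !addr_ge0.
  apply: filterS2 (cvg_norm_bounded l Ac) (cvg_norm_bounded l Bc) => m Am Bm phi p0.
  rewrite (le_trans (mulop_supn _ _ p0))// ler_wpM2r ?supn_ge0//.
  by rewrite ler_wpM2l// lerD.
move=> l phi p0 e e0.
have c0 : 0 < d%:R * supn phi + 1 by rewrite ltr_wpDl// mulr_ge0// supn_ge0.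
pose e' := e / 2 / (d%:R * supn phi + 1).
have e'0 : 0 < e' by rewrite !divr_gt0.
move/cvgrPdist_lt : (Ac l) => /(_ _ e'0) nA; move/cvgrPdist_lt : (Bc l) => /(_ _ e'0) nB.
apply: filterS2 nA nB => m Am Bm; rewrite /= mulop_sub.
rewrite (le_lt_trans (mulop_supn _ _ p0))// mulrAC distrC (distrC (B m)).
have : `|A l - A m| + `|B l - B m| < e / (d%:R * supn phi + 1).
  by move: Am Bm; rewrite /e' -mulrA [2^-1 * _]mulrC mulrA; lra.
rewrite ltr_pdivlMr// mulrC; apply: le_lt_trans.
by rewrite ler_wpM2r ?addr_ge0// lerDl.
Qed.

End Operators.

(** If [v] were nonzero, some [k] beyond [c] divided by its norm would contradict the bound, because
    [k < 2 ^ k]. This excludes the components that grow along a half-line. *)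
Lemma bounded_doubling_eq0 (R : realType) (V : normedModType R) (v : V) (c : R) :
  (forall k : nat, `|2 ^+ k *: v| <= c) -> v = 0.
Proof.
move=> H; apply/eqP; rewrite -normr_eq0; apply: contrapT => /negP v0.
have {}v0 : 0 < `|v| by rewrite lt_neqAle eq_sym v0 normr_ge0.
have c0 : 0 <= c by exact: le_trans (H 0%N).
have := archi_boundP (divr_ge0 c0 (ltW v0)).
set k := Num.bound _; rewrite ltr_pdivrMr// => ck.
have := H k; rewrite normrZ ger0_norm ?exprn_ge0// leNgt => /negP; apply.
rewrite (lt_le_trans ck)// ler_wpM2r// -natrX ler_nat.
exact/ltnW/ltn_expl.
Qed.

(** * Solving the equation on the two half-lines and matching at 0 *)

Section Hyperbolic.
Variables (R : realType) (d : nat).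
Local Notation seqd := (seqd R d).
Local Notation ell0 := (@ell0 R d).
Implicit Types (P Q : 'M[R]_d) (phi psi : seqd) (n : int).

Definition hypmx P : 'M[R]_d := 2^-1 *: P + 2 *: (1%:M - P).

Lemma hypmx_stable P (x : 'cV[R]_d) : P *m x = x -> hypmx P *m x = 2^-1 *: x.
Proof.
by move=> Px; rewrite mulmxDl -!scalemxAl mulmxBl mul1mx Px subrr scaler0 addr0.
Qed.

Lemma hypmx_unstable P (x : 'cV[R]_d) : P *m x = 0 -> hypmx P *m x = 2 *: x.
Proof.
by move=> Px; rewrite mulmxDl -!scalemxAl mulmxBl mul1mx Px scaler0 add0r subr0.
Qed.

(** The matrix acts as 1/2 on the range of [P] and as 2 on its kernel, so both components of a null
    vector vanish. *)
Lemma hypmx_unit P : P *m P = P -> hypmx P \in unitmx.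
Proof.
move=> PP; apply: unitmx_inj => x.
have PB : P *m (x - P *m x) = 0 by rewrite mulmxBr mulmxA PP subrr.
rewrite -{1}[x](subrK (P *m x)) mulmxDr (hypmx_unstable PB).
rewrite hypmx_stable ?mulmxA ?PP// => h.
have Px : P *m x = 0.
  have := congr1 (mulmx P) h; rewrite mulmxDr -!scalemxAr PB scaler0 add0r mulmx0.
  by rewrite mulmxA PP => /eqP; rewrite scaler_eq0 invr_eq0 pnatr_eq0 /= => /eqP.
move: h; rewrite Px subr0 scaler0 addr0 => /eqP.
by rewrite scaler_eq0 pnatr_eq0 /= => /eqP.
Qed.

Definition particular P psi : seqd :=
  fun n => P *m Uop psi n + (1%:M - P) *m Hop psi n.

Lemma particular_rec P psi n : P *m P = P -> ell0 psi ->
  particular P psi (n + 1) = hypmx P *m particular P psi n + psi n.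
Proof.
move=> PP p0; have [_ UR] := UopP p0; have [_ HR] := HopP p0.
rewrite /particular UR HR mulmxDr hypmx_stable ?mulmxA ?PP//.
rewrite -[hypmx P *m _ *m _]mulmxA hypmx_unstable; last first.
  by rewrite mulmxA mulmxBr mulmx1 PP subrr mul0mx.
rewrite !mulmxDr -!scalemxAr addrACA; congr (_ + _).
by rewrite -mulmxDl addrC subrK mul1mx.
Qed.

Lemma particular_bounded P psi : ell0 psi -> exists c, forall n, `|particular P psi n| <= c.
Proof.
move=> p0; have [U0 _] := UopP p0; have [H0 _] := HopP p0.
exists (d%:R * `|P| * supn (Uop psi) + d%:R * `|1%:M - P| * supn (Hop psi)) => n.
rewrite (le_trans (ler_normD _ _))// lerD// (le_trans (mx_norm_mul _ _))//.
  by rewrite ler_wpM2l ?mulr_ge0// supn_ub.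
by rewrite ler_wpM2l ?mulr_ge0// supn_ub.
Qed.

(** The only trace that [psi] leaves in the matching condition at 0:
    [particular Q psi 0 - particular P psi 0] equals [(Q - P) *m Dop psi]. *)
Definition Dop psi : 'cV[R]_d := Uop psi 0 - Hop psi 0.

(* For [P *m e = e], [gluesol P Q (e, psi)] solves the equation on [n >= 0], where it
   differs from [particular P psi] by [2^-n e]; on [n <= 0] it differs from
   [particular Q psi] by the term that matching at [0] forces, so it solves the
   equation there iff [obstr P Q (e, psi) = 0]. *)
Definition gluesol P Q (p : 'cV[R]_d * seqd) : seqd :=
  mulop P Q (Uop p.2) + mulop (1%:M - P) (1%:M - Q) (Hop p.2)
  + decay (p.1, p.1 - (Q - P) *m Dop p.2).

Definition obstr P Q (p : 'cV[R]_d * seqd) : 'cV[R]_d :=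
  Q *m p.1 - Q *m (1%:M - P) *m Dop p.2.

(** The inverse of [gluesol] in its first argument. With [psi] the image of [phi], the [P] component
    of [particular P psi] is that of [Uop psi], so this is the [P] component at 0 of
    [phi - particular P psi]. *)
Definition stablepart P Q phi : 'cV[R]_d :=
  P *m (phi 0 - Uop (shiftop phi - mulop (hypmx P) (hypmx Q) phi) 0).

Lemma gluesol_right P Q e psi (k : nat) :
  gluesol P Q (e, psi) k%:Z = particular P psi k%:Z + 2^-1 ^+ k *: e.
Proof. by []. Qed.

(** Only [k = 0] has content: there [gluesol] is defined by the data of the right half, and the
    second argument of [decay] is chosen to make the left formula agree with it. *)
Lemma gluesol_left P Q e psi (k : nat) :
  gluesol P Q (e, psi) (- k%:Z) =
  particular Q psi (- k%:Z) + 2^-1 ^+ k *: (e - (Q - P) *m Dop psi).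
Proof.
case: k => [|k]; last by rewrite -NegzE.
rewrite oppr0 gluesol_right expr0 !scale1r /particular /Dop mulmxBr !mulmxBl !mul1mx.
apply/matrixP => i j; rewrite !mxE; ring.
Qed.

(** The obstruction is [Q] applied to the coefficient of the left decaying term. When it vanishes,
    that coefficient is doubled by [hypmx Q], which is how [2^-|n|] evolves on negative indices. *)
Lemma gluesol_solves P Q e psi : P *m P = P -> Q *m Q = Q -> ell0 psi ->
  P *m e = e -> obstr P Q (e, psi) = 0 ->
  shiftop (gluesol P Q (e, psi)) - mulop (hypmx P) (hypmx Q) (gluesol P Q (e, psi)) = psi.
Proof.
move=> PP QQ p0 Pe; rewrite /obstr /= => ob.
have Qf : Q *m (e - (Q - P) *m Dop psi) = 0.
  by rewrite -ob mulmxBr; congr (_ - _); rewrite mulmxA !mulmxBr mulmx1 QQ.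
apply/funext => n.
rewrite -[LHS]/(gluesol P Q (e, psi) (n + 1) -
  signmx (hypmx P) (hypmx Q) n *m gluesol P Q (e, psi) n).
case: n => k.
  rewrite /signmx /= (_ : k%:Z + 1 = k.+1%:Z); last by lia.
  rewrite !gluesol_right (_ : k.+1%:Z = k%:Z + 1); last by lia.
  rewrite (particular_rec _ PP p0) [X in _ - X]mulmxDr -scalemxAr (hypmx_stable Pe).
  by rewrite scalerA -exprSr (addrAC _ (psi _)) [LHS]addrC addKr.
(* For [n = -1] the next index is 0, so the left formula is also used there. *)
rewrite /signmx NegzE (_ : - k.+1%:Z + 1 = - k%:Z); last by lia.
rewrite (_ : (0 <= - k.+1%:Z) = false); last by lia.
rewrite !gluesol_left (_ : - k%:Z = - k.+1%:Z + 1); last by lia.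
rewrite (particular_rec _ QQ p0) [X in _ - X]mulmxDr -scalemxAr (hypmx_unstable Qf).
by rewrite scalerA exprSr -mulrA mulVf// mulr1 (addrAC _ (psi _)) [LHS]addrC addKr.
Qed.

Lemma stablepart_gluesol P Q e psi : P *m P = P -> Q *m Q = Q -> ell0 psi ->
  P *m e = e -> obstr P Q (e, psi) = 0 ->
  stablepart P Q (gluesol P Q (e, psi)) = e.
Proof.
move=> PP QQ p0 Pe ob; rewrite /stablepart gluesol_solves// (gluesol_right _ _ _ _ 0).
rewrite expr0 scale1r /particular mulmxBr !mulmxDr !mulmxA mulmxBr mulmx1 PP subrr.
by rewrite mul0mx addr0 Pe addrAC subrr add0r.
Qed.

(** On each half-line the difference between [phi] and the particular solution is bounded and solves
    the homogeneous equation. To the right its [1 - P] component doubles at each step, to the left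
    its [Q] component doubles at each backward step; both must vanish, and only the decaying terms
    remain. *)
Lemma gluesol_complete P Q phi : P *m P = P -> Q *m Q = Q -> ell0 phi ->
  let psi := shiftop phi - mulop (hypmx P) (hypmx Q) phi in
  gluesol P Q (stablepart P Q phi, psi) = phi /\
  obstr P Q (stablepart P Q phi, psi) = 0.
Proof.
move=> PP QQ phi0 psi.
have psi0 : ell0 psi.
  by apply: (@sn_domB _ (sn_ell0 R d)); [exact: ell0_shift|exact: mulop_ell0].
have phiR n : phi (n + 1) = signmx (hypmx P) (hypmx Q) n *m phi n + psi n.
  rewrite -[psi n]/(phi (n + 1) - signmx (hypmx P) (hypmx Q) n *m phi n).
  by rewrite [RHS]addrC subrK.
set e := stablepart P Q phi.
have [c Hc] := ell0_bounded phi0.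
pose r n := phi n - particular P psi n.
have rR (k : nat) : r k.+1%:Z = hypmx P *m r k%:Z.
  rewrite /r (_ : k.+1%:Z = k%:Z + 1); last by lia.
  rewrite phiR (particular_rec _ PP psi0) /signmx /= mulmxBr opprD addrACA.
  by rewrite subrr addr0.
have hP : P *m hypmx P = 2^-1 *: P.
  by rewrite mulmxDr -!scalemxAr PP mulmxBr mulmx1 PP subrr scaler0 addr0.
have hC : (1%:M - P) *m hypmx P = 2 *: (1%:M - P).
  by rewrite mulmxBl mul1mx hP /hypmx addrC addKr.
have rC (k : nat) : (1%:M - P) *m r k%:Z = 2 ^+ k *: ((1%:M - P) *m r 0).
  elim: k => [|k IH]; first by rewrite expr0 scale1r.
  by rewrite rR mulmxA hC -scalemxAl IH scalerA -exprS.
have [c1 Hc1] := particular_bounded P psi0.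
have r0C : (1%:M - P) *m r 0 = 0.
  apply: (@bounded_doubling_eq0 _ _ _ (d%:R * `|1%:M - P| * (c + c1))) => k.
  rewrite -rC (le_trans (mx_norm_mul _ _))// ler_wpM2l ?mulr_ge0//.
  by rewrite (le_trans (ler_normB _ _))// lerD.
have r0e : r 0 = e.
  rewrite -[r 0]mul1mx -[1%:M](subrK P) mulmxDl r0C add0r /r /particular.
  rewrite /e /stablepart -/psi !mulmxBr mulmxDr !mulmxA PP mulmxBr mulmx1 PP subrr.
  by rewrite mul0mx addr0.
have Pe : P *m e = e by rewrite /e /stablepart mulmxA PP.
have rE (k : nat) : r k%:Z = 2^-1 ^+ k *: e.
  elim: k => [|k IH]; first by rewrite expr0 scale1r.
  by rewrite rR IH -scalemxAr (hypmx_stable Pe) scalerA -exprSr.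
pose f := e - (Q - P) *m Dop psi.
pose r' n := phi n - particular Q psi n.
have r'R (k : nat) : r' (- k%:Z) = hypmx Q *m r' (- k.+1%:Z).
  rewrite /r' {1 2}(_ : - k%:Z = - k.+1%:Z + 1); last by lia.
  rewrite phiR (particular_rec _ QQ psi0) /signmx.
  rewrite (_ : (0 <= - k.+1%:Z) = false); last by lia.
  by rewrite mulmxBr opprD addrACA subrr addr0.
have hQ : Q *m hypmx Q = 2^-1 *: Q.
  by rewrite mulmxDr -!scalemxAr QQ mulmxBr mulmx1 QQ subrr scaler0 addr0.
have r'Q (k : nat) : Q *m r' (- k%:Z) = 2 ^+ k *: (Q *m r' 0).
  elim: k => [|k IH]; first by rewrite expr0 scale1r.
  rewrite exprS -scalerA -IH (r'R k) mulmxA hQ -scalemxAl scalerA mulfV//.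
  by rewrite scale1r.
have [c2 Hc2] := particular_bounded Q psi0.
have r'0Q : Q *m r' 0 = 0.
  apply: (@bounded_doubling_eq0 _ _ _ (d%:R * `|Q| * (c + c2))) => k.
  rewrite -r'Q (le_trans (mx_norm_mul _ _))// ler_wpM2l ?mulr_ge0//.
  by rewrite (le_trans (ler_normB _ _))// lerD.
(* Both remainders come from the same [phi], so at 0 they differ by the gap between the two
   particular solutions. Then [Q *m r' 0 = 0] is the vanishing of the obstruction. *)
have r'0f : r' 0 = f.
  rewrite /f -r0e /r /r' /particular /Dop mulmxBr !mulmxBl !mul1mx.
  by apply/matrixP => i j; rewrite !mxE; ring.
have r'E (k : nat) : r' (- k%:Z) = 2^-1 ^+ k *: f.
  elim: k => [|k IH]; first by rewrite expr0 scale1r.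
  have Qr : Q *m r' (- k.+1%:Z) = 0 by rewrite r'Q r'0Q scaler0.
  move: IH; rewrite (r'R k) (hypmx_unstable Qr) exprS -scalerA => <-.
  by rewrite scalerA mulVf// scale1r.
split.
  apply/funext => -[k|k].
    by rewrite gluesol_right -rE /r addrC subrK.
  by rewrite NegzE gluesol_left -/f -r'E /r' addrC subrK.
rewrite -r'0Q r'0f /f /obstr /= [RHS]mulmxBr; congr (_ - _).
by rewrite mulmxA !mulmxBr mulmx1 QQ.
Qed.

End Hyperbolic.

(** * Impulses at -1, which first act at time 0 *)

Section Delta.
Variables (R : realType) (d : nat).
Local Notation ell0 := (@ell0 R d).

Definition delta (y : 'cV[R]_d) : seqd R d := fun n => if n == -1 then y else 0.

Lemma delta_ell0 y : ell0 (delta y).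
Proof.
apply/ell0P => e e0; exists 2%N => n n2; rewrite /delta ifF ?normr0//.
by apply/eqP; lia.
Qed.

Lemma Uop_delta y : Uop (delta y) = decay (y, 0).
Proof.
apply/esym/half_unique; [exact: decay_ell0|exact: delta_ell0|].
case=> [k|[|k]].
- rewrite (_ : k%:Z + 1 = k.+1%:Z); last by lia.
  by rewrite /decay /delta /= addr0 exprS scalerA.
- rewrite (_ : Negz 0 + 1 = 0); last by lia.
  by rewrite /decay /delta /= scaler0 expr0 scale1r; rewrite scaler0 add0r.
- rewrite (_ : Negz k.+1 + 1 = Negz k); last by lia.
  by rewrite /decay /delta /= !scaler0 addr0.
Qed.

Lemma Hop_delta y : Hop (delta y) = decay (0, - y).
Proof.
apply/esym/double_unique; [exact: decay_ell0|exact: delta_ell0|].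
case=> [k|[|k]].
- rewrite (_ : k%:Z + 1 = k.+1%:Z); last by lia.
  by rewrite /decay /delta /= !scaler0 addr0.
- rewrite (_ : Negz 0 + 1 = 0); last by lia.
  by rewrite /decay /delta /= scaler0 expr1 scalerA mulfV// scale1r addNr.
- rewrite (_ : Negz k.+1 + 1 = Negz k); last by lia.
  by rewrite /decay /delta /= addr0 [in RHS]exprS scalerA mulrA mulfV// mul1r.
Qed.

(** The response [Uop] to the impulse starts with the value [y] at 0, while the response [Hop] lives
    on negative indices and is 0 there. Hence [d] impulses suffice to make [Dop] onto. *)
Lemma Dop_delta y : Dop (delta y) = y.
Proof. by rewrite /Dop Uop_delta Hop_delta /decay /= scaler0 subr0 expr0 scale1r. Qed.

End Delta.

(** * The operator family, its Fredholm property and its index *)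

Section Index.
Variables (R : realType) (Lam : metricType R) (d : nat).
Variables (P Q : Lam -> 'M[R]_d).
Hypotheses (Pc : continuous P) (Qc : continuous Q).
Hypotheses (PT : forall l, (P l)^T = P l) (QT : forall l, (Q l)^T = Q l).
Hypotheses (PP : forall l, P l *m P l = P l) (QQ : forall l, Q l *m Q l = Q l).
Local Notation ell0 := (@ell0 R d).
Local Notation sn_ell0 := (sn_ell0 R d).
Local Notation vec := (sn_vec R).

Definition hypfam (l : Lam) (n : int) : 'M[R]_d := signmx (hypmx (P l)) (hypmx (Q l)) n.
Local Notation L := (Lop hypfam).

Lemma LopE l phi : L l phi = shiftop phi - mulop (hypmx (P l)) (hypmx (Q l)) phi.
Proof. by []. Qed.

Lemma hypmx_continuous (A : Lam -> 'M[R]_d) : continuous A ->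
  continuous (fun l => hypmx (A l)).
Proof.
move=> Ac l; rewrite /hypmx; apply: cvgD; apply: cvgZr => //; first exact: Ac.
by apply: cvgB; [exact: cvg_cst|exact: Ac].
Qed.

Lemma compl_continuous (A : Lam -> 'M[R]_d) : continuous A ->
  continuous (fun l => 1%:M - A l).
Proof. by move=> Ac l; apply: cvgB; [exact: cvg_cst|exact: Ac]. Qed.

Lemma mulmx_continuous m n p (A : Lam -> 'M[R]_(m, n)) (B : Lam -> 'M[R]_(n, p)) :
  continuous A -> continuous B -> continuous (fun l => A l *m B l).
Proof. by move=> Ac Bc l; apply: cvg_mulmx; [exact: Ac|exact: Bc]. Qed.

Lemma trmx_continuous m n (A : Lam -> 'M[R]_(m, n)) :
  continuous A -> continuous (fun l => (A l)^T).
Proof. by move=> Ac l; apply: cvg_trmx; exact: Ac. Qed.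

Lemma cstmx_continuous m n (B : 'M[R]_(m, n)) : continuous (fun _ : Lam => B).
Proof. by move=> l; exact: cvg_cst. Qed.

Lemma scont_L : scont (A := sn_ell0) (B := sn_ell0) L.
Proof.
apply: (scont_sub (scont_shiftop d Lam)).
by apply: scont_mulop; exact: hypmx_continuous.
Qed.

Lemma scont_Dop : scont (Lam := Lam) (A := sn_ell0) (B := vec d) (fun _ => @Dop R d).
Proof.
exact: (scont_sub (scont_comp (scont_Uop d Lam) (scont_ev d Lam 0))
                  (scont_comp (scont_Hop d Lam) (scont_ev d Lam 0))).
Qed.

Lemma scont_gluesol : scont (A := sn_prod (vec d) sn_ell0) (B := sn_ell0)
  (fun l => gluesol (P l) (Q l)).
Proof.
have s1 := scont_fst Lam (vec d) sn_ell0; have s2 := scont_snd Lam (vec d) sn_ell0.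
have sU := scont_comp (scont_comp s2 (scont_Uop d Lam)) (scont_mulop Pc Qc).
have sH := scont_comp (scont_comp s2 (scont_Hop d Lam))
  (scont_mulop (compl_continuous Pc) (compl_continuous Qc)).
have QPc : continuous (fun l => Q l - P l).
  by move=> l; apply: cvgB; [exact: Qc|exact: Pc].
have sf := scont_sub s1 (scont_comp (scont_comp s2 scont_Dop) (scont_mx QPc)).
exact: (scontD (scontD sU sH) (scont_comp (scont_pair s1 sf) (scont_decay d Lam))).
Qed.

Lemma scont_obstr : scont (A := sn_prod (vec d) sn_ell0) (B := vec d)
  (fun l => obstr (P l) (Q l)).
Proof.
have s1 := scont_fst Lam (vec d) sn_ell0; have s2 := scont_snd Lam (vec d) sn_ell0.
exact: (scont_sub (scont_comp s1 (scont_mx Qc))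
  (scont_comp (scont_comp s2 scont_Dop)
    (scont_mx (mulmx_continuous Qc (compl_continuous Pc))))).
Qed.

Lemma scont_stablepart : scont (A := sn_ell0) (B := vec d)
  (fun l => stablepart (P l) (Q l)).
Proof.
exact: (scont_comp (scont_sub (scont_ev d Lam 0)
  (scont_comp (scont_comp scont_L (scont_Uop d Lam)) (scont_ev d Lam 0)))
  (scont_mx Pc)).
Qed.

Lemma stable_fix l phi : P l *m stablepart (P l) (Q l) phi = stablepart (P l) (Q l) phi.
Proof. by rewrite /stablepart mulmxA PP. Qed.

(** Subtracting the impulse [delta (Dop psi)] makes [Dop] vanish; the obstruction with [e = 0] is
    then 0, and the remaining sequence is in the range for every parameter. *)
Lemma transversal_delta : Defs.transversal L (fun i : 'I_d => delta (delta_mx i 0 : 'cV[R]_d)).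
Proof.
split=> [i|l psi p0]; first exact: delta_ell0.
pose z := Dop psi.
have z0 := delta_ell0 z.
have pz0 : ell0 (psi - delta z) by exact: (@sn_domB _ sn_ell0).
have Dz : Dop (psi - delta z) = 0.
  have := scontB l scont_Dop p0 z0.
  by rewrite Dop_delta subrr.
exists (gluesol (P l) (Q l) (0, psi - delta z)), (delta z); split.
  have [+ _ _ _] := scont_gluesol; apply; split => //=.
split.
  exists (fun i => z i 0); apply/funext => n; rewrite fct_sumE.
  transitivity (\sum_i z i 0 *: (if n == -1 then delta_mx i 0 else 0 : 'cV[R]_d)) => //.
  rewrite /delta; case: ifP => _.
    by rewrite {1}[z]matrix_sum_delta; apply: eq_bigr => i _; rewrite big_ord1.
  by rewrite big1// => i _; rewrite scaler0.
rewrite LopE gluesol_solves// ?subrK ?mulmx0//.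
by rewrite /obstr /= Dz !mulmx0 subrr.
Qed.

(** The kernel consists of the [gluesol (e, 0)] with [e] fixed by [P] and killed by [Q]. The range
    is cut out by finitely many bounded linear conditions on [Dop psi], so it is closed, and
    impulses complement it. *)
Lemma L_fredholm l : fredholm (L l).
Proof.
have [Ld LL Lb _] := scont_L.
split; first exact: Ld.
split; first exact: LL.
split.
  have [C _ nC] := Lb l; exists C; exact: (nbhs_singleton nC).
split.
  (* The space of [e] with [P e = e] and [Q e = 0], as a row space: [kermx] acts on row vectors,
     hence the transposes. *)
  pose S := kermx (row_mx (1%:M - P l)^T (Q l)^T).
  have sg0 : scont (A := vec d) (B := sn_ell0) (fun l e => gluesol (P l) (Q l) (e, 0)).
    apply: (scont_comp (B := sn_prod (vec d) sn_ell0) (f := fun _ e => (e, 0)) _ scont_gluesol).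
    apply: (@scont_cst _ _ (vec d) (sn_prod (vec d) sn_ell0) _ 1) => //.
    - by move=> x _; split => //; exact: ell0_0.
    - move=> a x y _ _; by rewrite -[RHS]/(a *: x + y, a *: (0 : seqd R d) + 0) scaler0 addr0.
    - by move=> x _; rewrite mul1r /= /nsum /= supn0 ge_max lexx normr_ge0.
  have Dop0 : Dop (0 : seqd R d) = 0.
    have := scontB l scont_Dop (@ell0_0 R d) (@ell0_0 R d).
    by rewrite !subrr.
  have SP (e : 'cV[R]_d) : (e^T <= S)%MS <-> P l *m e = e /\ Q l *m e = 0.
    split.
      move/sub_kermxP; rewrite mul_mx_row -!trmx_mul => h.
      have := congr1 lsubmx h; have := congr1 rsubmx h; rewrite row_mxKl row_mxKr !linear0.
      move=> /(congr1 trmx); rewrite trmxK trmx0 => ->.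
      move=> /(congr1 trmx); rewrite trmxK trmx0 mulmxBl mul1mx => /eqP.
      by rewrite subr_eq0 => /eqP.
    move=> [Pe Qe]; apply/sub_kermxP; rewrite mul_mx_row -!trmx_mul Qe mulmxBl mul1mx Pe.
    by rewrite subrr !trmx0 row_mx0.
  exists d, (fun i => gluesol (P l) (Q l) ((row i S)^T, 0)); split.
    by move=> i; have [+ _ _ _] := sg0; apply.
  apply/seteqP; split => phi.
    move=> [phi0 Lphi].
    have [] := gluesol_complete (PP l) (QQ l) phi0; rewrite -LopE Lphi.
    set e := stablepart _ _ _ => ge; rewrite /obstr /= Dop0 mulmx0 subr0 => Qe.
    have /SP/submxP[c ec] := conj (stable_fix l phi) Qe.
    exists (fun i => c 0 i); rewrite -[LHS]ge.
    rewrite -(scont_sum (A := vec d) (B := sn_ell0) l _ sg0)//; congr (gluesol _ _ (_, _)).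
    apply: trmx_inj; rewrite ec mulmx_sum_row linear_sum; apply: eq_bigr => i _.
    by rewrite linearZ /= trmxK.
  move=> [c ->]; rewrite -(scont_sum (A := vec d) (B := sn_ell0) l _ sg0)//.
  set e := \sum_i _.
  have /SP[Pe Qe] : (e^T <= S)%MS.
    apply/submxP; exists (\row_i c i); rewrite mulmx_sum_row linear_sum.
    by apply: eq_bigr => i _; rewrite linearZ /= trmxK mxE.
  split; first by have [+ _ _ _] := sg0; apply.
  rewrite LopE gluesol_solves//; first exact: ell0_0.
  by rewrite /obstr /= Dop0 mulmx0 Qe subrr.
split; last first.
  have [b0 tb] := transversal_delta.
  by exists d, (fun i : 'I_d => delta (delta_mx i 0 : 'cV[R]_d)); split => // psi; exact: tb.
move=> psi p0 happ.
(* A sequence [psi] is in the range iff [Q (1 - P) Dop psi] lies in the range of [Q P]. The cokernel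
   turns this into the linear equations [B *m Dop psi = 0]. *)
pose W := (Q l *m P l)^T.
pose B := (cokermx W)^T *m (Q l *m (1%:M - P l)).
have BL phi : ell0 phi -> B *m Dop (L l phi) = 0.
  move=> phi0; have [_] := gluesol_complete (PP l) (QQ l) phi0; rewrite -LopE /obstr /=.
  move=> /eqP; rewrite subr_eq0 => /eqP ob; rewrite -mulmxA -ob.
  rewrite -stable_fix (mulmxA (Q l)); apply: trmx_inj.
  by rewrite trmx_mul trmxK trmx_mul -/W -mulmxA mulmx_coker mulmx0 trmx0.
have sB := scont_comp scont_Dop (scont_mx (@cstmx_continuous _ _ B)).
have [_ _ sBb _] := sB; have [C C0 nC] := sBb l; have {}nC := nbhs_singleton nC.
(* A bounded map that vanishes on the range vanishes on its closure. *)
have Bpsi : B *m Dop psi = 0.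
  apply/eqP; rewrite -normr_eq0; apply: contrapT => /negP v0.
  have {}v0 : 0 < `|B *m Dop psi| by rewrite lt_neqAle eq_sym v0 normr_ge0.
  have C1 : 0 < C + 1 by rewrite ltr_wpDl.
  have [phi [phi0 sphi]] := happ _ (divr_gt0 v0 C1).
  have dd : ell0 (L l phi - psi) by apply: (@sn_domB _ sn_ell0) => //; exact: Ld.
  have := nC _ dd; rewrite /= (scontB l sB) ?BL//; last exact: Ld.
  rewrite sub0r normrN => h.
  have : C * supn (L l phi - psi) < `|B *m Dop psi|.
    move: sphi; rewrite ltr_pdivlMr// mulrDr mulr1 mulrC; apply: le_lt_trans.
    by rewrite lerDl supn_ge0.
  by move=> /(le_lt_trans h); rewrite ltxx.
have : ((Q l *m (1%:M - P l) *m Dop psi)^T <= W)%MS.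
  rewrite submxE; apply/eqP; apply: trmx_inj; rewrite trmx_mul trmxK trmx0.
  by rewrite mulmxA; exact: Bpsi.
case/submxP => x ex.
have Pe : P l *m (P l *m x^T) = P l *m x^T by rewrite mulmxA PP.
have ob : obstr (P l) (Q l) (P l *m x^T, psi) = 0.
  rewrite /obstr /=; apply/eqP; rewrite subr_eq0; apply/eqP; apply: trmx_inj.
  by rewrite ex /W !trmx_mul trmxK mulmxA.
exists (gluesol (P l) (Q l) (P l *m x^T, psi)); split; last first.
  by rewrite LopE gluesol_solves.
by have [+ _ _ _] := scont_gluesol; apply.
Qed.

(** Only two matrices occur along the whole sequence, so their continuity is uniform in [n] and
    gives continuity in operator norm. *)
Lemma L_cont_fredholm_family : cont_fredholm_family L.
Proof.
split=> [|l e e0]; first exact: L_fredholm.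
have d1 : 0 < d%:R + 1 :> R by rewrite ltr_wpDl.
pose e' := e / 2 / (d%:R + 1).
have e'0 : 0 < e' by rewrite !divr_gt0.
have /nbhs_ballP[r /= r0 Hr] : \forall m \near l,
    `|hypmx (P m) - hypmx (P l)| < e' /\ `|hypmx (Q m) - hypmx (Q l)| < e'.
  move/cvgrPdist_lt : (hypmx_continuous Pc (x := l)) => /(_ _ e'0) nA.
  move/cvgrPdist_lt : (hypmx_continuous Qc (x := l)) => /(_ _ e'0) nB.
  by apply: filterS2 nA nB => m; rewrite (distrC (hypmx (P l))) (distrC (hypmx (Q l))).
exists r; split => // m /Hr[Am Bm] phi p0.
rewrite !LopE opprD addrACA subrr add0r -opprD.
rewrite opprB mulop_sub (le_trans (mulop_supn _ _ p0))// ler_wpM2r ?supn_ge0//.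
rewrite distrC (distrC (hypmx (Q l))).
have h : `|hypmx (P m) - hypmx (P l)| + `|hypmx (Q m) - hypmx (Q l)| < e / (d%:R + 1).
  by move: Am Bm; rewrite /e' -mulrA [2^-1 * _]mulrC mulrA; lra.
move: h; rewrite ltr_pdivlMr// mulrC => /ltW; apply: le_trans.
by rewrite ler_wpM2r ?addr_ge0// lerDl.
Qed.

(** * A fixed admissible V: the obstruction as a matrix, its right inverse and its kernel *)

Section Transversal.
Variables (k : nat) (b : 'I_k -> seqd R d).
Hypothesis tb : Defs.transversal L b.

Lemma comb_ell0 c : ell0 (comb b c).
Proof.
have [b0 _] := tb; apply: (big_ind ell0); first exact: ell0_0.
  by move=> x y; exact: (@sn_domD _ sn_ell0).
by move=> i _; apply: (@sn_domZ _ sn_ell0); exact: b0.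
Qed.

Lemma span_comb v : Defs.span b v <-> exists c, v = comb b c.
Proof.
split=> [[c ->]|[c ->]]; last by exists (fun i => c i 0).
by exists (\col_i c i); apply: eq_bigr => i _; rewrite mxE.
Qed.

Definition Dmx : 'M[R]_(d, k) := \matrix_(i, j) Dop (b j) i 0.

Lemma Dop_comb (l : Lam) c : Dop (comb b c) = Dmx *m c.
Proof.
have [b0 _] := tb.
have := scont_sum l (fun i => c i 0) scont_Dop b0; rewrite -/(comb b c) => ->.
apply/matrixP => i j; rewrite mxE summxE; apply: eq_bigr => h _.
by rewrite !mxE ord1 mulrC.
Qed.

(** The obstruction map T in the coordinates of [R^d + R^k]. Using [Q P] instead of [Q] extends it
    from the range of [P] by 0 on the kernel of [P]. *)
Definition obs1 l := Q l *m P l.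
Definition obs2 l := - (Q l *m (1%:M - P l) *m Dmx).

Lemma obstr_comb l x c : P l *m x = x ->
  obstr (P l) (Q l) (x, comb b c) = obs1 l *m x + obs2 l *m c.
Proof.
by move=> Px; rewrite /obstr /= (Dop_comb l) /obs1 -[Q l *m P l *m x]mulmxA Px mulNmx !mulmxA.
Qed.

Lemma Q_obs1 l : Q l *m obs1 l = obs1 l. Proof. by rewrite /obs1 mulmxA QQ. Qed.

Lemma Q_obs2 l : Q l *m obs2 l = obs2 l.
Proof. by rewrite /obs2 mulmxN !mulmxA QQ. Qed.

Lemma obs1_P l : obs1 l *m P l = obs1 l. Proof. by rewrite /obs1 -mulmxA PP. Qed.

(** The pair [(P y, delta (- y))] has obstruction [Q P y + Q (1 - P) y = y]. Transversality writes
    [delta (- y)] as [L phi + v]; subtracting [(stablepart phi, L phi)], which has obstruction 0,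
    leaves a pair whose sequence [v] is in V. *)
Lemma obstr_surj l (y : 'cV[R]_d) : Q l *m y = y ->
  exists (x : 'cV[R]_d) (c : 'cV[R]_k), obs1 l *m x + obs2 l *m c = y.
Proof.
move=> Qy; have [_ tb2] := tb.
have [phi [v [phi0 [/span_comb[c vc] dE]]]] := tb2 l _ (delta_ell0 (- y)).
have [Ld _ _ _] := scont_L.
exists (P l *m y - stablepart (P l) (Q l) phi), c.
rewrite -obstr_comb; last by rewrite mulmxBr stable_fix mulmxA PP.
have -> : comb b c = delta (- y) - L l phi by rewrite dE vc addrC addKr.
have d1 : prod_dom (A := vec d) (B := sn_ell0) (P l *m y, delta (- y)).
  by split => //; exact: delta_ell0.
have d2 : prod_dom (A := vec d) (B := sn_ell0) (stablepart (P l) (Q l) phi, L l phi).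
  by split => //; exact: Ld.
have := scontB l scont_obstr d1 d2.
have [_ ob] := gluesol_complete (PP l) (QQ l) phi0.
rewrite [obstr _ _ (stablepart _ _ _, _)]ob subr0 => h; apply: (etrans h).
rewrite /obstr /= Dop_delta mulmxN opprK mulmxA -mulmxDl -mulmxDr.
by rewrite addrC subrK mulmx1.
Qed.

(** T T^t, completed by the identity on the kernel of [Q] so that it can be inverted on all of
    [R^d]. *)
Definition gram l := obs1 l *m (obs1 l)^T + obs2 l *m (obs2 l)^T + (1%:M - Q l).

(** The quadratic form is a sum of three squares. If it vanishes at [x], then [x] is in the range of
    [Q] and T^t x = 0; surjectivity gives x = T z, so x^t x = z^t T^t x = 0. *)
Lemma gram_unit l : gram l \in unitmx.
Proof.
apply: unitmx_inj => x gx.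
(* Symmetry and idempotence exhibit the third term as a square as well. *)
have CT : (1%:M - Q l) = (1%:M - Q l)^T *m (1%:M - Q l).
  have -> : (1%:M - Q l)^T = 1%:M - Q l by rewrite linearB /= trmx1 QT.
  by rewrite mulmxBl mul1mx mulmxBr mulmx1 QQ subrr subr0.
have sq n (z : 'cV[R]_n) : 0 <= (z^T *m z) 0 0.
  by rewrite mxE sumr_ge0// => i _; rewrite mxE -expr2 sqr_ge0.
have h : x^T *m gram l *m x = ((obs1 l)^T *m x)^T *m ((obs1 l)^T *m x)
    + ((obs2 l)^T *m x)^T *m ((obs2 l)^T *m x)
    + ((1%:M - Q l) *m x)^T *m ((1%:M - Q l) *m x).
  rewrite /gram [X in _ + X]CT; move: (1%:M - Q l) => C.
  by rewrite !trmx_mul !trmxK !mulmxDr !mulmxDl !mulmxA.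
move: h; rewrite -mulmxA gx mulmx0 => /esym/matrixP/(_ 0 0).
rewrite 2![in LHS]mxE [RHS]mxE => /eqP.
rewrite paddr_eq0 ?addr_ge0// => /andP[]; rewrite paddr_eq0// => /andP[/eqP h1 /eqP h2] /eqP h3.
have ent n (z : 'cV[R]_n) : (z^T *m z) 0 0 = 0 -> z = 0.
  by move=> z0; apply: trmx_self_eq0; apply/matrixP => i j; rewrite !ord1 z0 mxE.
have {}h1 := ent _ _ h1; have {}h2 := ent _ _ h2; have {}h3 := ent _ _ h3.
have Qx : Q l *m x = x.
  by move/eqP: h3; rewrite mulmxBl mul1mx subr_eq0 => /eqP.
have [z [c zc]] := obstr_surj Qx.
have xT : x^T = z^T *m (obs1 l)^T + c^T *m (obs2 l)^T.
  by rewrite -[in LHS]zc linearD /= !trmx_mul.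
by apply: trmx_self_eq0; rewrite xT mulmxDl -!mulmxA h1 h2 !mulmx0 addr0.
Qed.

(** The two components of the right inverse T^t (T T^t)^-1, with [gram] in place of T T^t. *)
Definition sec1 l := (obs1 l)^T *m invmx (gram l).
Definition sec2 l := (obs2 l)^T *m invmx (gram l).

Lemma obs_sec l : obs1 l *m sec1 l + obs2 l *m sec2 l = Q l.
Proof.
have -> : obs1 l *m sec1 l + obs2 l *m sec2 l = Q l *m gram l *m invmx (gram l).
  have -> : Q l *m gram l = obs1 l *m (obs1 l)^T + obs2 l *m (obs2 l)^T.
    have C0 : Q l *m (1%:M - Q l) = 0 by rewrite mulmxBr mulmx1 QQ subrr.
    rewrite /gram [LHS]mulmxDr C0 addr0 [LHS]mulmxDr mulmxA (mulmxA _ (obs2 l)).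
    by rewrite Q_obs1 Q_obs2.
  by rewrite [RHS]mulmxDl; congr (_ + _); exact: mulmxA.
by rewrite mulmxK// gram_unit.
Qed.

Lemma P_sec1 l : P l *m sec1 l = sec1 l.
Proof.
rewrite /sec1 mulmxA; congr (_ *m _).
by apply: trmx_inj; rewrite trmx_mul trmxK PT obs1_P.
Qed.

Lemma obs1_continuous : continuous obs1.
Proof. exact: mulmx_continuous. Qed.

Lemma obs2_continuous : continuous obs2.
Proof.
move=> l; apply: cvgN; apply: cvg_mulmx; last exact: cvg_cst.
by apply: cvg_mulmx; [exact: Qc|exact: (compl_continuous Pc)].
Qed.

Lemma gram_continuous : continuous gram.
Proof.
have h1 := mulmx_continuous obs1_continuous (trmx_continuous obs1_continuous).
have h2 := mulmx_continuous obs2_continuous (trmx_continuous obs2_continuous).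
move=> l; apply: cvgD; last exact: (compl_continuous Qc).
by apply: cvgD; [exact: h1|exact: h2].
Qed.

Lemma sec1_continuous : continuous sec1.
Proof.
move=> l; apply: cvg_mulmx; first exact: (trmx_continuous obs1_continuous).
by apply: cvg_invmx; [exact: gram_continuous|exact: gram_unit].
Qed.

Lemma sec2_continuous : continuous sec2.
Proof.
move=> l; apply: cvg_mulmx; first exact: (trmx_continuous obs2_continuous).
by apply: cvg_invmx; [exact: gram_continuous|exact: gram_unit].
Qed.

Definition obssec l (y : 'cV[R]_d) : 'cV[R]_d * seqd R d :=
  (sec1 l *m y, comb b (sec2 l *m y)).

Lemma scont_obssec : scont (A := vec d) (B := sn_prod (vec d) sn_ell0) obssec.
Proof.
have [b0 _] := tb.
exact: (scont_pair (scont_mx sec1_continuous)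
  (scont_comp (scont_mx sec2_continuous) (scont_comb Lam b0))).
Qed.

Lemma obstr_obssec l y : Q l *m y = y -> obstr (P l) (Q l) (obssec l y) = y.
Proof.
move=> Qy; rewrite /obssec obstr_comb; last by rewrite mulmxA P_sec1.
by rewrite (mulmxA (obs1 l)) (mulmxA (obs2 l)) -mulmxDl obs_sec.
Qed.

(** The kernel of T is identified with E(L,V) by [gluesol], with inverse
    [phi -> (stablepart phi, L phi)]; [f] adds the section applied to the F component. Its inverse
    [g] reads that component off as the obstruction and removes it before gluing. *)
Lemma index_ko_eq (E F : Lam -> set 'cV[R]_d) :
  (forall l x, E l x <-> P l *m x = x) -> (forall l x, F l x <-> Q l *m x = x) ->
  ko_eq (@supn R d) (EL L b) (@supn R d) (fun=> Defs.span b)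
    (fun v : 'cV[R]_d => `|v|) E (fun v : 'cV[R]_d => `|v|) F.
Proof.
(* The isomorphism holds without stabilization, so [G] has rank 0. *)
move=> EP FQ; exists ('cV[R]_0 : normedModType R), (fun=> setT); split.
  split=> [//|l0]; exists 0%N, (fun _ _ => 0), 1; split => //; split; first by case.
  move=> l _; split; first by case.
  move=> x _; exists (fun=> 0); split; first by rewrite big_ord0 [x]flatmx0.
  by move=> c _; apply/funext => -[].
have [Ld _ _ _] := scont_L; have [gd _ _ _] := scont_gluesol.
have [sd _ _ _] := scont_obssec.
have [_ obL _ _] := scont_obstr.
pose f l (p : seqd R d * 'cV[R]_d * 'cV[R]_0) : 'cV[R]_d * seqd R d * 'cV[R]_0 :=
  ((stablepart (P l) (Q l) p.1.1, L l p.1.1) + obssec l p.1.2, p.2).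
pose g l (p : 'cV[R]_d * seqd R d * 'cV[R]_0) : seqd R d * 'cV[R]_d * 'cV[R]_0 :=
  ((gluesol (P l) (Q l) (p.1 - obssec l (obstr (P l) (Q l) p.1)),
    obstr (P l) (Q l) p.1), p.2).
pose A := sn_prod (sn_prod sn_ell0 (vec d)) (vec 0).
pose B := sn_prod (sn_prod (vec d) sn_ell0) (vec 0).
have sf : scont (A := A) (B := B) f.
  have s1 := scont_fst Lam (sn_prod sn_ell0 (vec d)) (vec 0).
  have s2 := scont_snd Lam (sn_prod sn_ell0 (vec d)) (vec 0).
  have s11 := scont_comp s1 (scont_fst Lam sn_ell0 (vec d)).
  have s12 := scont_comp s1 (scont_snd Lam sn_ell0 (vec d)).
  exact: (scont_pair (scontD (scont_comp s11 (scont_pair scont_stablepart scont_L))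
    (scont_comp s12 scont_obssec)) s2).
have sg : scont (A := B) (B := A) g.
  have s1 := scont_fst Lam (sn_prod (vec d) sn_ell0) (vec 0).
  have s2 := scont_snd Lam (sn_prod (vec d) sn_ell0) (vec 0).
  have so := scont_comp s1 scont_obstr.
  exact: (scont_pair (scont_pair (scont_comp
    (scont_sub s1 (scont_comp so scont_obssec)) scont_gluesol) so) s2).
have domA l x : bsum (bsum (EL L b) F) (fun=> setT) l x -> sn_dom (s := A) x.
  by move=> [[[]]].
have spanD v c : Defs.span b v -> Defs.span b (v + comb b c).
  move=> /span_comb[c' ->]; apply/span_comb; exists (c' + c).
  rewrite /comb -big_split; apply: eq_bigr => i _ /=.
  by rewrite mxE scalerDl.
have spanB v c : Defs.span b v -> Defs.span b (v - comb b c).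
  move=> /span_comb[c' ->]; apply/span_comb; exists (c' - c).
  rewrite /comb -sumrB; apply: eq_bigr => i _.
  by rewrite !mxE scalerBl.
have span0 v : Defs.span b v -> ell0 v.
  by move=> /span_comb[c ->]; exact: comb_ell0.
have domB l x : bsum (bsum E (fun=> Defs.span b)) (fun=> setT) l x -> sn_dom (s := B) x.
  by move=> [[_ /span0 ?] _]; split => //; split.
have Qob l p : Q l *m obstr (P l) (Q l) p = obstr (P l) (Q l) p.
  by rewrite /obstr mulmxBr !mulmxA QQ.
(* Subtracting the section of the obstruction projects onto the kernel of T. *)
have obB l e psi : ell0 psi -> obstr (P l) (Q l)
    ((e, psi) - obssec l (obstr (P l) (Q l) (e, psi))) = 0.
  move=> p0; have d1 : prod_dom (A := vec d) (B := sn_ell0) (e, psi) by split.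
  apply: (etrans (scontB l scont_obstr d1 (sd l _ I))).
  by rewrite obstr_obssec ?Qob// subrr.
have gsol l e psi : P l *m e = e -> ell0 psi ->
    let q := (e, psi) - obssec l (obstr (P l) (Q l) (e, psi)) in
    L l (gluesol (P l) (Q l) q) = q.2 /\ stablepart (P l) (Q l) (gluesol (P l) (Q l) q) = q.1.
  move=> Pe p0 q; have ob0 : obstr (P l) (Q l) q = 0 by exact: obB.
  have Pq : P l *m q.1 = q.1 by rewrite /q /= mulmxBr Pe mulmxA P_sec1.
  have q0 : ell0 q.2 by apply: (@sn_domB _ sn_ell0) => //; exact: comb_ell0.
  rewrite [q]surjective_pairing in ob0 *.
  by rewrite LopE gluesol_solves// stablepart_gluesol.
exists f, g; split; [|split; [|split; [|split; [|split; [|split]]]]].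
- move=> l [[phi y] w] [[/= [phi0 Lphi] /FQ Qy] _]; split => //=; split => /=.
    by apply/EP; rewrite mulmxDr stable_fix mulmxA P_sec1.
  exact: spanD.
- move=> l [[e psi] w] [[/= /EP Pe psib] _]; split => //=; split => /=.
    have p0 := span0 _ psib; have [Lq _] := gsol l e psi Pe p0.
    split; last by rewrite Lq /=; exact: spanB.
    apply: gd; split => //=; apply: (@sn_domB _ sn_ell0) => //; exact: comb_ell0.
  by apply/FQ; rewrite Qob.
- by move=> l a x y /domA dx /domA dy; have [_ fL _ _] := sf; exact: fL.
- move=> l [[phi y] w] [[/= [phi0 Lphi] /FQ Qy] _]; rewrite /g /f /=.
  have d1 : prod_dom (A := vec d) (B := sn_ell0) (stablepart (P l) (Q l) phi, L l phi).
    by split => //; exact: Ld.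
  have [gl ob] := gluesol_complete (PP l) (QQ l) phi0.
  have -> : obstr (P l) (Q l) ((stablepart (P l) (Q l) phi, L l phi) + obssec l y) = y.
    have := obL l 1 _ _ d1 (sd l y I); rewrite !scale1r => h; apply: (etrans h).
    by rewrite [obstr _ _ (stablepart _ _ _, _)]ob add0r obstr_obssec.
  by rewrite addrK; congr (_, _, _); exact: gl.
- move=> l [[e psi] w] [[/= /EP Pe psib] _]; rewrite /g /f /=.
  have [Lq sq] := gsol l e psi Pe (span0 _ psib).
  by rewrite Lq sq -surjective_pairing subrK.
- exact: (scont_tot sf domA).
- exact: (scont_tot sg domB).
Qed.

Lemma scont_gluesol_comb :
  scont (A := vec (d + k)) (B := sn_ell0)
    (fun l x => gluesol (P l) (Q l) (usubmx x, comb b (dsubmx x))).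
Proof.
have [b0 _] := tb.
have su : scont (Lam := Lam) (A := vec (d + k)) (B := vec d) (fun _ x => usubmx x).
  apply: (@scont_cst _ _ (vec (d + k)) (vec d) _ 1) => //.
    by move=> a x y _ _; rewrite linearP.
  move=> x _; rewrite mul1r /=; apply: mx_norm_le => // i j.
  by rewrite mxE mx_norm_entry.
have sd : scont (Lam := Lam) (A := vec (d + k)) (B := vec k) (fun _ x => dsubmx x).
  apply: (@scont_cst _ _ (vec (d + k)) (vec k) _ 1) => //.
    by move=> a x y _ _; rewrite linearP.
  move=> x _; rewrite mul1r /=; apply: mx_norm_le => // i j.
  by rewrite mxE mx_norm_entry.
exact: (scont_comp (scont_pair su (scont_comp sd (scont_comb Lam b0))) scont_gluesol).
Qed.

(* The projection of [R^(d+k)] onto the kernel of the obstruction map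
   [im P x R^k -> im Q]. *)
Definition kerproj l : 'M[R]_(d + k) :=
  block_mx (P l) 0 0 1%:M - col_mx (sec1 l) (sec2 l) *m row_mx (obs1 l) (obs2 l).

Lemma kerproj_continuous : continuous kerproj.
Proof.
move=> l; apply: cvgB.
  by apply: cvg_col_mx; apply: cvg_row_mx; [exact: Pc|exact: cvg_cst|exact: cvg_cst|exact: cvg_cst].
apply: cvg_mulmx; first by apply: cvg_col_mx; [exact: sec1_continuous|exact: sec2_continuous].
by apply: cvg_row_mx; [exact: obs1_continuous|exact: obs2_continuous].
Qed.

Lemma kerproj_col l (x : 'cV[R]_d) (c : 'cV[R]_k) :
  let z := obs1 l *m x + obs2 l *m c in
  kerproj l *m col_mx x c = col_mx (P l *m x - sec1 l *m z) (c - sec2 l *m z).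
Proof.
move=> z; rewrite /kerproj mulmxBl mul_block_col mul0mx mul0mx mul1mx addr0 add0r.
rewrite -(mulmxA (col_mx _ _)) mul_row_col -/z mul_col_mx.
by rewrite opp_col_mx add_col_mx.
Qed.

(** A fixed vector forces both components of the section to vanish at [z], the value of T; as T
    after the section is [Q], and [z] is in the range of [Q], this gives [z = 0]. *)
Lemma kerproj_fix l (x : 'cV[R]_d) (c : 'cV[R]_k) :
  kerproj l *m col_mx x c = col_mx x c <->
  P l *m x = x /\ obs1 l *m x + obs2 l *m c = 0.
Proof.
rewrite kerproj_col; set z := obs1 l *m x + obs2 l *m c; split; last first.
  by move=> [-> ->]; rewrite !mulmx0 !subr0.
move=> /eq_col_mx[h1 h2].
have s2 : sec2 l *m z = 0 by move: h2 => /(congr1 (fun y => c - y)); rewrite subKr subrr.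
have s1 : sec1 l *m z = 0.
  have := congr1 (mulmx (P l)) h1; rewrite mulmxBr (mulmxA (P l)) PP (mulmxA _ (sec1 l)) P_sec1.
  by move=> /(congr1 (fun y => P l *m x - y)); rewrite subKr subrr.
split; first by move: h1; rewrite s1 subr0.
have Qz : Q l *m z = z by rewrite /z mulmxDr (mulmxA _ (obs1 l)) (mulmxA _ (obs2 l)) Q_obs1 Q_obs2.
by rewrite -Qz -obs_sec mulmxDl -(mulmxA (obs1 l)) -(mulmxA (obs2 l)) s1 s2 !mulmx0 addr0.
Qed.

Lemma kerproj_idem l : kerproj l *m kerproj l = kerproj l.
Proof.
apply: mulmx_col_inj => x; rewrite -mulmxA -[x]vsubmxK kerproj_col.
set y := usubmx x; set c := dsubmx x; set z := obs1 l *m y + obs2 l *m c.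
apply/kerproj_fix; split.
  by rewrite mulmxBr (mulmxA (P l)) PP (mulmxA _ (sec1 l)) P_sec1.
have Qz : Q l *m z = z by rewrite /z mulmxDr (mulmxA _ (obs1 l)) (mulmxA _ (obs2 l)) Q_obs1 Q_obs2.
rewrite !mulmxBr (mulmxA _ (P l)) obs1_P addrACA -/z -opprD.
by rewrite (mulmxA (obs1 l)) (mulmxA (obs2 l)) -mulmxDl obs_sec Qz subrr.
Qed.

(** E(L,V) is the image of the range of [kerproj] under [gluesol]. This map is injective there:
    [stablepart] recovers the first block, [L] recovers [comb b c], and independence of [b] recovers
    [c]. *)
Lemma EL_bundle_indep : (forall c, comb b c = 0 -> c = 0) ->
  is_bundle (@supn R d) (EL L b).
Proof.
move=> binj.
have Lglue l x : kerproj l *m x = x ->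
    L l (gluesol (P l) (Q l) (usubmx x, comb b (dsubmx x))) = comb b (dsubmx x) /\
    stablepart (P l) (Q l) (gluesol (P l) (Q l) (usubmx x, comb b (dsubmx x))) = usubmx x.
  rewrite -{1 2}[x]vsubmxK => /kerproj_fix[Px ob].
  have c0 := comb_ell0 (dsubmx x); rewrite -obstr_comb// in ob.
  by rewrite LopE gluesol_solves// stablepart_gluesol.
have -> : EL L b = fun l => [set gluesol (P l) (Q l) (usubmx x, comb b (dsubmx x)) |
    x in [set x : 'cV[R]_(d + k) | kerproj l *m x = x]].
  apply/funext => l; apply/seteqP; split => phi.
    move=> [phi0 /span_comb[c Lc]].
    have [gl ob] := gluesol_complete (PP l) (QQ l) phi0.
    rewrite -LopE Lc obstr_comb ?stable_fix// in ob.
    exists (col_mx (stablepart (P l) (Q l) phi) c) => /=.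
      by apply/kerproj_fix; rewrite stable_fix.
    by rewrite col_mxKu col_mxKd -Lc.
  move=> [x /= /Lglue[Lx _] <-]; split.
    by have [+ _ _ _] := scont_gluesol_comb; apply.
  by apply/span_comb; exists (dsubmx x).
apply: (bundle_of_proj (A := sn_ell0) kerproj_continuous kerproj_idem scont_gluesol_comb).
move=> l x /Lglue[]; move=> + + g0; rewrite g0 => L0 s0.
have z0 := scontB l scont_L (@ell0_0 R d) (@ell0_0 R d).
have z1 := scontB l scont_stablepart (@ell0_0 R d) (@ell0_0 R d).
rewrite !subrr in z0 z1.
rewrite -[x]vsubmxK -s0 [X in col_mx X _]z1 (binj (dsubmx x)) ?col_mx0//.
by rewrite -L0.
Qed.

End Transversal.

(** E(L,V) and transversality depend on the generators only through their span, so an independent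
    family may replace them. *)
Lemma EL_bundle k (b : 'I_k -> seqd R d) : Defs.transversal L b ->
  is_bundle (@supn R d) (EL L b).
Proof.
move=> tb; have [b0 tb2] := tb.
have [k' [b' [sb ib]]] := span_indep b.
have -> : EL L b = EL L b' by rewrite /EL sb.
apply: EL_bundle_indep.
  split=> [i|]; last by rewrite sb.
  have : Defs.span b (b' i).
    rewrite -sb; exists (fun j => (j == i)%:R); rewrite (bigD1 i)//= eqxx scale1r.
    by rewrite big1 ?addr0// => j /negbTE ->; rewrite scale0r.
  by move=> /span_comb[c ->]; exact: (comb_ell0 tb).
move=> c c0; apply/matrixP => i j; rewrite ord1 mxE.
exact: (ib (fun i => c i 0)).
Qed.

End Index.

Theorem theorem6p5 (R : realType) (Lam : metricType R) (d : nat)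
    (E F : Lam -> set 'cV[R]_d) :
  compact [set: Lam] -> path_connected R Lam ->
  is_bundle (fun v : 'cV[R]_d => `|v|) E ->
  is_bundle (fun v : 'cV[R]_d => `|v|) F ->
  exists A : Lam -> int -> 'M[R]_d,
    (forall n : int, continuous (fun l => A l n)) /\
    (forall l n, A l n \in unitmx) /\
    cont_fredholm_family (Lop A) /\
    index_eq (Lop A) E F.
Proof.
move=> _ _ /bundle_orthproj[P [Pc PE]] /bundle_orthproj[Q [Qc QF]].
have PT l : (P l)^T = P l by have [] := PE l.
have PP l : P l *m P l = P l by have [] := PE l.
have QT l : (Q l)^T = Q l by have [] := QF l.
have QQ l : Q l *m Q l = Q l by have [] := QF l.
exists (hypfam P Q); split; [|split; [|split]].
- by move=> n; rewrite /hypfam /signmx; case: (0 <= n); exact: hypmx_continuous.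
- by move=> l n; rewrite /hypfam /signmx; case: (0 <= n); exact: hypmx_unit.
- exact: L_cont_fredholm_family.
split.
  exists d, (fun i : 'I_d => delta (delta_mx i 0 : 'cV[R]_d)).
  exact: transversal_delta.
move=> k b tb; split; first exact: EL_bundle.
apply: index_ko_eq => // l x.
- by have [] := PE l.
- by have [] := QF l.
Qed.
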